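(* Let $d\ge 1$ be an integer. The following two properties of the Ornstein-Uhlenbeck semigroup $\{Q_t\}_{t\ge 0}$ on $\mathbb{R}^d$ are equivalent. (i) (Hypercontractivity) For every $p>1$ and every $f\in L^p(\gamma_d)$, $$\|Q_tf\|_{q(t)}\le\|f\|_p\quad\text{for all }t\ge 0,\qquad\text{where } q(t)=e^{2t}(p-1)+1.$$ (ii) For every $f\in L^1(\gamma_d)$ with $e^f\in L^1(\gamma_d)$, $$\|\exp(Q_tf)\|_{e^{2t}}\le\|e^f\|_1\quad\text{for all }t\ge 0.$$
   Context: $\gamma_d$ is the standard Gaussian measure on $\mathbb{R}^d$; $L^p(\gamma_d)$ ($p>0$) is the set of measurable $f:\mathbb{R}^d\to\mathbb{R}$ with $\int|f|^p\,d\gamma_d<\infty$, and $\|f\|_p=\left(\int|f|^p\,d\gamma_d\right)^{1/p}$. The Ornstein-Uhlenbeck semigroup is, for $f\in L^1(\gamma_d)$ and $t\ge 0$, $$(Q_tf)(x)=\int_{\mathbb{R}^d}f\bigl(e^{-t}x+\sqrt{1-e^{-2t}}\,y\bigr)\,\gamma_d(dy),$$ which is finite for $\gamma_d$-a.e. $x$. *)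

(* Defs.v *)
From HB Require Import structures.
From mathcomp Require Import all_boot all_order all_algebra.
From mathcomp Require Import all_classical all_reals all_analysis.

Set Implicit Arguments.
Unset Strict Implicit.
Unset Printing Implicit Defensive.
Import Order.TTheory GRing.Theory Num.Theory.
Import numFieldNormedType.Exports.

Local Open Scope classical_set_scope.
Local Open Scope ring_scope.

(* R^d as d-tuples of reals: the library's sigma-algebra on d.-tuple is the one
   generated by the coordinates, here the Borel sigma-algebra of R^d. *)
Notation Rn R d := (d.-tuple (measurableTypeR R)).

Section gauss.
Variable R : realType.

Definition consT (d : nat) (x : measurableTypeR R * Rn R d) : Rn R d.+1 :=
  [the d.+1.-tuple (measurableTypeR R) of x.1 :: x.2].

Lemma measurable_consT d : measurable_fun [set: _] (@consT d).
Proof. exact: measurable_cons. Qed.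

HB.instance Definition _ d :=
  isMeasurableFun.Build _ _ _ _ (@consT d) (@measurable_consT d).

(* gamma_d as the d-fold product of the law N(0, 1); see std_gauss_box. *)
Fixpoint std_gauss (d : nat) : probability (Rn R d) R :=
  if d is d'.+1 then
    distribution (normal_prob 0 1 \x std_gauss d')%E (@consT d')
  else dirac ([tuple] : Rn R 0).

Lemma std_gauss_box (d : nat) (A : 'I_d -> set (measurableTypeR R)) :
  (forall i, measurable (A i)) ->
  std_gauss d [set x | forall i, A i (tnth x i)] =
  (\prod_(i < d) normal_prob 0 1 (A i))%E.
Proof.
elim: d A => [|d IHd] A mA.
  rewrite big_ord0 /= diracE mem_set//= => -[]//.
rewrite big_ord_recl -(IHd (fun i => A (lift ord0 i)))//.
rewrite /= /distribution /pushforward.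
rewrite (_ : _ @^-1` _ =
    A ord0 `*` [set x : Rn R d | forall i, A (lift ord0 i) (tnth x i)]).
  rewrite product_measure1E//.
  rewrite (_ : [set x | _] =
      \bigcap_(i in [set: 'I_d]) (@tnth d _ ^~ i @^-1` A (lift ord0 i))); last first.
    by apply/seteqP; split=> [x Ax i _|x Ax i]; [exact: Ax|exact: (Ax i)].
  apply: fin_bigcap_measurable => [|i _]; first exact: finite_finset.
  rewrite -[X in measurable X]setTI.
  exact: (@measurable_tnth _ (measurableTypeR R) d i).
apply/seteqP; split=> -[a x] /= Ax.
  split; first exact: (Ax ord0).
  by move=> i; have := Ax (lift ord0 i); rewrite tnthS.
by case: Ax => Aa Ax i; case: (unliftP ord0 i) => [j ->|->]; rewrite ?tnthS.
Qed.

Definition mehler_pt (d : nat) (t : R) (x y : Rn R d) : Rn R d :=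
  [tuple expR (- t) * tnth x i + Num.sqrt (1 - expR (- (2 * t))) * tnth y i
  | i < d].

(* Valued in \bar R: for f in L^1(gamma_d) the integrand is integrable for
   almost every x, and on the exceptional null set the library's convention for
   the integral (+oo - oo = -oo) is used, which no Lnorm of OU t f sees. *)
Definition OU (d : nat) (t : R) (f : Rn R d -> R) (x : Rn R d) : \bar R :=
  (\int[std_gauss d]_y (f (mehler_pt t x y))%:E)%E.

End gauss.

(* Main.v *)
(** Hypercontractivity (i) is Nelson's theorem, so it is enough to prove it
outright and to deduce (ii) from it.

For (i) => (ii), apply (i) to [exp (f / p)]: Jensen's inequality gives
[exp (Q_t f) <= (Q_t (exp (f / p))) ^ p], and p -> oo by Fatou's lemma.

For (i), put rho = exp (- t), b = 1 / p and a = 1 - 1 / q(t), so that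
rho^2 a b = (1 - a) (1 - b).  By duality (i) amounts to
[E (F(X)^a G(Y)^b) <= (E F(X))^a (E G(Y))^b] for a rho-correlated pair (X, Y) of
standard Gaussian vectors, which tensorizes, so that d = 1 suffices.  There,
think of (X, Y) as the endpoint of a planar Brownian motion.  Over a step of
length s^2, a second order expansion of u^a v^b shows that the inequality holds
up to O(s^3), because the quadratic form
- a(1-a)/2 x^2 + a b rho x y - b(1-b)/2 y^2 is nonpositive.  Doubling the time
also doubles the error, so 2^k steps with s^2 = 2^-k cost O(2^(-k/2)).  The
expansion is legitimate for functions smoothed by a Gaussian.  The smoothing is
removed for functions F such that F z >= F x for all z near x, and the
general case follows by outer regularity. *)
Require Import Defs.
From HB Require Import structures.
From mathcomp Require Import all_boot all_order all_algebra.
From mathcomp Require Import all_classical all_reals all_analysis.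
From mathcomp Require Import measurable_realfun ring lra.
Import Order.TTheory GRing.Theory Num.Theory.
Import numFieldNormedType.Exports.
Local Open Scope classical_set_scope.
Local Open Scope ring_scope.

(** * Gaussian integrals *)

(** The duality is realized by [u = Q_t f] itself: with [F = u^q] and [G = f^p] the left side of the
    bilinear inequality is the integral of [u^(q-1) Q_t f = u^q], and a power of it cancels. This
    requires a finite integral, hence bounded functions first and truncation at the end. In the
    doubling argument the error constant must be the same at every stage. The functions met on the
    way are smoothings of [F] and [G] at increasing levels, so the constant is made uniform over all
    levels above a fixed positive one. It also involves bounds [eps <= F <= M] with [eps > 0],
    because increments are measured relative to their mean; [eps] is removed by adding a small
    constant. The smoothing is removed with an Ornstein-Uhlenbeck operator because it preserves
    Gaussian integrals: the right side stays put and only the left side has a limit to pass. There a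
    lower bound on the smoothed functions suffices, which is what [F z >= F x] near [x] provides. As
    the left side is monotone in [F] and [G], indicators may first be enlarged to those of open sets
    at small cost. *)

Section lebesgue_affine.
Context {R : realType}.
Local Notation leb := (@lebesgue_measure R).

Definition affine_map (a b : R) (x : measurableTypeR R) : measurableTypeR R :=
  a * x + b.

Lemma measurable_affine_map (a b : R) : measurable_fun setT (affine_map a b).
Proof. by apply: measurable_funD => //; exact: measurable_funM. Qed.

(** By uniqueness of Lebesgue measure it suffices to compute the scaled pushforward on half-open
    intervals. *)
Lemma affine_lebesgue_measure (a b : R) (a0 : 0 < a) (A : set R) :
  measurable A ->
  leb A = (a%:E * leb (affine_map a b @^-1` A))%E.
Proof.
move=> mA.
pose mu' : {measure set (measurableTypeR R) -> \bar R} :=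
  mscale (NngNum (ltW a0)) (pushforward leb (affine_map a b)).
rewrite (@lebesgue_measure_unique _ (mu' (measurable_affine_map a b)))//= => _ [[u v]] _ <-.
rewrite /mu' /mscale/= /pushforward.
have -> : affine_map a b @^-1` `]u, v]%classic = `](u - b) / a, (v - b) / a]%classic.
  apply/seteqP; split => x /=; rewrite !in_itv/= /affine_map;
  by rewrite ltr_pdivrMr// ler_pdivlMr// ltrBlDr lerBrDr ![a * _]mulrC.
rewrite !lebesgue_measure_itv/= !lte_fin ltr_pM2r ?invr_gt0// ltrD2r.
case: ifPn; rewrite ?mule0// -?EFinB -?EFinM => _; congr EFin.
by field; rewrite gt_eqF.
Qed.

Lemma ge0_integral_affine (a b : R) (f : R -> \bar R) :
  0 < a -> measurable_fun setT f -> (forall x, 0 <= f x)%E ->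
  (\int[leb]_x f x = a%:E * \int[leb]_x f (a * x + b)%R)%E.
Proof.
move=> a0 mf f0.
rewrite [in RHS](_ : (fun x => _) = f \o affine_map a b)//.
have -> : (\int[leb]_x (f \o affine_map a b) x =
    \int[pushforward leb (affine_map a b)]_x f x)%E.
  by rewrite ge0_integral_pushforward//=; exact: measurable_affine_map.
rewrite -[a%:E]/((NngNum (ltW a0))%:num%:E).
have ma := measurable_affine_map a b.
rewrite -(@ge0_integral_mscale _ _ _ (pushforward leb (affine_map a b)))//.
by apply: eq_measure_integral => A mA _; exact: affine_lebesgue_measure.
Qed.

Lemma ge0_integral_lebesgueN (f : R -> \bar R) :
  measurable_fun setT f -> (forall x, 0 <= f x)%E ->
  (\int[leb]_x f (- x)%R = \int[leb]_x f x)%E.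
Proof.
move=> mf f0.
transitivity (\int[pushforward leb (-%R : _ -> measurableTypeR R)]_x f x)%E.
  by rewrite ge0_integral_pushforward.
by apply: eq_measure_integral => A mA _; exact: lebesgue_measureN.
Qed.

End lebesgue_affine.

Section gauss1.
Context {R : realType}.
Local Notation leb := (@lebesgue_measure R).
Local Notation gam := (normal_prob (0 : R) 1).
Local Notation phi := (normal_pdf (0 : R) 1).

Lemma normal_pdf01E x : phi x = normal_peak 1 * expR (- (x ^+ 2 / 2)).
Proof.
by rewrite normal_pdfE ?oner_eq0// /normal_fun subr0 expr1n mulNr -mulr_natr mul1r.
Qed.

(** Change of variables brings in the Radon-Nikodym derivative, which agrees almost everywhere with
    [phi] because both have the same integral over every measurable set. *)
Lemma ge0_integral_gauss (f : R -> \bar R) :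
  measurable_fun setT f -> (forall x, 0 <= f x)%E ->
  (\int[gam]_x f x = \int[leb]_x (f x * (phi x)%:E))%E.
Proof.
move=> mf f0.
have dom := @normal_prob_dominates R 0 1.
rewrite -(Radon_Nikodym_SigmaFinite.change_of_variables dom)//.
have mp : measurable_fun setT (fun x => (phi x)%:E).
  by apply/measurable_EFinP; exact: measurable_normal_pdf.
have iRN := Radon_Nikodym_SigmaFinite.f_integrable dom.
apply: ae_eq_integral => //.
- by apply: emeasurable_funM => //; exact: measurable_int iRN.
- exact: emeasurable_funM.
- apply: ae_eqe_mul2l.
  apply: integral_ae_eq => // A _ mA.
  by rewrite -(Radon_Nikodym_SigmaFinite.f_integral dom).
Qed.

Lemma ge0_integral_gaussN (f : R -> \bar R) :
  measurable_fun setT f -> (forall x, 0 <= f x)%E ->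
  (\int[gam]_x f (- x)%R = \int[gam]_x f x)%E.
Proof.
move=> mf f0.
have mp : measurable_fun setT (fun x => (phi x)%:E).
  by apply/measurable_EFinP; exact: measurable_normal_pdf.
rewrite !ge0_integral_gauss//; last exact: measurableT_comp.
rewrite -[RHS]ge0_integral_lebesgueN; last 2 first.
- exact: emeasurable_funM.
- by move=> x; rewrite mule_ge0// lee_fin normal_pdf_ge0.
by apply: eq_integral => x _ /=; rewrite !normal_pdf01E sqrrN.
Qed.

(** The Cameron-Martin formula in dimension one. It yields the moment generating function, and later
    lets a translation act on the Gaussian density instead of on a function that is merely
    measurable. *)
Lemma ge0_integral_gauss_shift (f : R -> \bar R) (k : R) :
  measurable_fun setT f -> (forall x, 0 <= f x)%E ->
  (\int[gam]_x f (x + k)%R =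
   \int[gam]_x (f x * (expR (k * x - k ^+ 2 / 2))%:E))%E.
Proof.
move=> mf f0.
have mp : measurable_fun setT (fun x => (phi x)%:E).
  by apply/measurable_EFinP; exact: measurable_normal_pdf.
have me : measurable_fun setT (fun x => (expR (k * x - k ^+ 2 / 2))%:E).
  apply/measurable_EFinP; apply: measurableT_comp => //.
  by apply: measurable_funB => //; exact: measurable_funM.
rewrite !ge0_integral_gauss//; last 3 first.
- exact: emeasurable_funM.
- by move=> x; rewrite mule_ge0// lee_fin expR_ge0.
- by apply: measurableT_comp => //; exact: measurable_funD.
rewrite [RHS](@ge0_integral_affine _ 1 k)//; last 2 first.
- by apply: emeasurable_funM => //; exact: emeasurable_funM.
- by move=> x; rewrite !mule_ge0// lee_fin ?expR_ge0 ?normal_pdf_ge0.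
rewrite mul1e; apply: eq_integral => x _.
rewrite mul1r -muleA; congr (_ * _)%E.
rewrite -EFinM; congr EFin; rewrite !normal_pdf01E mulrCA -expRD.
by congr (_ * expR _); field.
Qed.

(** Rotation invariance: [a X + b Y] has the law of [c X] for independent standard [X] and [Y]. The
    value [b = 0] is allowed, which covers correlation 1. The proof substitutes [w = a x + b y] in
    the inner integral and exchanges the order of integration. *)
Lemma ge0_integral_gauss_rot (a b c : R) (f : R -> \bar R) :
  0 < a -> 0 < c -> c ^+ 2 = a ^+ 2 + b ^+ 2 ->
  measurable_fun setT f -> (forall x, 0 <= f x)%E ->
  (\int[gam]_x \int[gam]_y f (a * x + b * y)%R = \int[gam]_x f (c * x)%R)%E.
Proof.
move=> a0 c0 cab mf f0.
have mp : measurable_fun setT phi by exact: measurable_normal_pdf.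
have mpE : measurable_fun setT (fun x => (phi x)%:E) by exact/measurable_EFinP.
have mab : measurable_fun setT (fun z : R * R => a * z.1 + b * z.2).
  by apply: measurable_funD; apply: measurable_funM.
have mF : measurable_fun setT (fun z : R * R => f (a * z.1 + b * z.2)).
  exact: measurableT_comp.
have := @fubini_tonelli _ _ _ _ _ gam gam _ mF (fun=> f0 _) => /= ->.
pose h (z : R * R) : \bar R :=
  (f z.2 * (phi (a^-1 * z.2 + - (b / a * z.1)) * phi z.1)%:E)%E.
have h0 z : (0 <= h z)%E.
  by rewrite mule_ge0// lee_fin mulr_ge0// normal_pdf_ge0.
have mh : measurable_fun setT h.
  apply: emeasurable_funM; first exact: measurableT_comp.
  apply/measurable_EFinP; apply: measurable_funM; last exact: measurableT_comp.
  apply: (measurableT_comp mp); apply: measurable_funD.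
    exact: measurable_funM.
  by apply: measurableT_comp => //; exact: measurable_funM.
transitivity (\int[gam]_y (a^-1%:E * \int[leb]_w
    (f w * (phi (a^-1 * w + - (b / a * y)))%:E)))%E.
  apply: eq_integral => y _.
  rewrite ge0_integral_gauss; last 2 first.
  - by apply: (measurableT_comp mf); apply: measurable_funD => //; exact: measurable_funM.
  - by [].
  rewrite [in RHS](@ge0_integral_affine _ a (b * y))//; last 2 first.
  - apply: emeasurable_funM => //; apply/measurable_EFinP.
    by apply: (measurableT_comp mp); apply: measurable_funD => //; exact: measurable_funM.
  - by move=> x; rewrite mule_ge0// lee_fin normal_pdf_ge0.
  rewrite muleA -EFinM mulVf ?gt_eqF// mul1e.
  apply: eq_integral => x _; congr (_ * (phi _)%:E)%E.
  by field; rewrite gt_eqF.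
have mi y : measurable_fun setT (fun w => (f w * (phi (a^-1 * w + - (b / a * y)))%:E)%E).
  apply: emeasurable_funM => //; apply/measurable_EFinP.
  by apply: (measurableT_comp mp); apply: measurable_funD => //; exact: measurable_funM.
have mi2 : measurable_fun setT (fun y => \int[leb]_w (f w * (phi (a^-1 * w + - (b / a * y)))%:E))%E.
  pose k (z : R * R) := (f z.2 * (phi (a^-1 * z.2 + - (b / a * z.1)))%:E)%E.
  have mk : measurable_fun setT k.
    apply: emeasurable_funM; first exact: measurableT_comp.
    apply/measurable_EFinP.
    apply: (measurableT_comp mp); apply: measurable_funD.
      exact: measurable_funM.
    by apply: measurableT_comp => //; exact: measurable_funM.
  have k0 z : (0 <= k z)%E by rewrite mule_ge0// lee_fin normal_pdf_ge0.
  exact: (@measurable_fun_fubini_tonelli_F _ _ _ _ _ leb k mk k0).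
have i0 y : (0 <= \int[leb]_w (f w * (phi (a^-1 * w + - (b / a * y)))%:E))%E.
  by apply: integral_ge0 => w _; rewrite mule_ge0// lee_fin normal_pdf_ge0.
rewrite ge0_integralZl; last 4 first.
- exact: measurableT.
- exact: mi2.
- by move=> y _.
- by rewrite lee_fin invr_ge0 ltW.
rewrite ge0_integral_gauss; last 2 first.
- exact: mi2.
- exact: i0.
transitivity (a^-1%:E * \int[leb]_y \int[leb]_w h (y, w))%E.
  congr (_ * _)%E; apply: eq_integral => y _.
  rewrite -ge0_integralZr; last 4 first.
  - exact: measurableT.
  - exact: mi.
  - by move=> w _; rewrite mule_ge0// lee_fin normal_pdf_ge0.
  - by rewrite lee_fin normal_pdf_ge0.
  by apply: eq_integral => w _; rewrite /h/= EFinM muleA.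
rewrite (@fubini_tonelli _ _ _ _ _ leb leb h mh h0).
(* Completing the square: given [w], the variable [y] is Gaussian with mean [b w / c^2] and standard
   deviation [a / c], so integrating out [y] leaves the factor [a / c]. *)
have key w y : phi (a^-1 * w + - (b / a * y)) * phi y =
    phi (c^-1 * w) * phi (c / a * y + - (b / (a * c) * w)).
  rewrite !normal_pdf01E mulrACA [RHS]mulrACA -!expRD; congr (_ * expR _).
  have a20 : a ^+ 2 != 0 by rewrite gt_eqF// exprn_gt0.
  have c20 : c ^+ 2 != 0 by rewrite gt_eqF// exprn_gt0.
  have -> : - ((a^-1 * w + - (b / a * y)) ^+ 2 / 2) + - (y ^+ 2 / 2) =
     - ((w ^+ 2 - 2 * b * w * y + (a ^+ 2 + b ^+ 2) * y ^+ 2) / a ^+ 2 / 2).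
    by field; rewrite gt_eqF.
  have -> : - ((c^-1 * w) ^+ 2 / 2) + - ((c / a * y + - (b / (a * c) * w)) ^+ 2 / 2) =
     - (((a ^+ 2 + b ^+ 2) / c ^+ 2 * w ^+ 2 - 2 * b * w * y + c ^+ 2 * y ^+ 2) / a ^+ 2 / 2).
    by field; rewrite !gt_eqF.
  by rewrite -cab divff// mul1r.
have inner w : (\int[leb]_y h (y, w) = f w * (phi (c^-1 * w))%:E * (a / c)%:E)%E.
  have -> : (\int[leb]_y h (y, w) = \int[leb]_y ((f w * (phi (c^-1 * w))%:E) * (phi (c / a * y + - (b / (a * c) * w)))%:E))%E.
    by apply: eq_integral => y _; rewrite /h/= key EFinM muleA.
  have mm : measurable_fun setT (fun y => (phi (c / a * y + - (b / (a * c) * w)))%:E).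
    apply/measurable_EFinP; apply: (measurableT_comp mp).
    by apply: measurable_funD => //; exact: measurable_funM.
  rewrite ge0_integralZl//; last 2 first.
  - by move=> y _; rewrite lee_fin normal_pdf_ge0.
  - by rewrite mule_ge0// lee_fin normal_pdf_ge0.
  congr (_ * _)%E.
  have := @ge0_integral_affine R (c / a) (- (b / (a * c) * w)) (fun x => (phi x)%:E).
  rewrite integral_normal_pdf => /(_ _ mpE) e.
  have {e}/= := e (divr_gt0 c0 a0) (fun x => @normal_pdf_ge0 R 0 1 x).
  move=> /(congr1 (fun z => (a / c)%:E * z)%E).
  rewrite mule1 muleA -EFinM => ->.
  by rewrite (_ : a / c * (c / a) = 1) ?mul1e//; field; rewrite !gt_eqF.
under eq_integral do rewrite inner.
have mcp : measurable_fun setT (fun x => (phi (c^-1 * x))%:E).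
  by apply/measurable_EFinP; apply: (measurableT_comp mp); exact: measurable_funM.
rewrite ge0_integralZr//; last 3 first.
- exact: emeasurable_funM.
- by move=> x _; rewrite mule_ge0// lee_fin normal_pdf_ge0.
- by rewrite lee_fin divr_ge0// ltW.
rewrite (@ge0_integral_affine _ c 0)//; last 2 first.
- exact: emeasurable_funM.
- by move=> x; rewrite mule_ge0// lee_fin normal_pdf_ge0.
rewrite [RHS]ge0_integral_gauss//; last first.
  by apply: (measurableT_comp mf); exact: measurable_funM.
rewrite [(_ * (a / c)%:E)%E]muleC 2!muleA -!EFinM (_ : _ * c = 1); last first.
  by field; rewrite !gt_eqF.
rewrite mul1e; apply: eq_integral => x _.
by rewrite addr0 mulrA mulVf ?gt_eqF// mul1r.
Qed.

End gauss1.

Section gauss_moments.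
Context {R : realType}.
Local Notation gam := (normal_prob (0 : R) 1).

Lemma measurable_expRM (k : R) : measurable_fun setT (fun x : R => expR (k * x)).
Proof. by apply: measurableT_comp => //; exact: measurable_funM. Qed.

Lemma gauss_mgf (k : R) :
  (\int[gam]_x (expR (k * x))%:E = (expR (k ^+ 2 / 2))%:E)%E.
Proof.
have := @ge0_integral_gauss_shift R (fun=> (expR (k ^+ 2 / 2))%:E) k.
rewrite integral_cst// [X in (_ * X)%E](_ : _ = 1%E); last first.
  exact: probability_setT.
rewrite mule1 => -> //.
apply: eq_integral => x _; rewrite -EFinM -expRD; congr (expR _)%:E.
by rewrite addrC subrK.
Qed.

Lemma integrable_gauss_expR (k : R) :
  gam.-integrable setT (fun x => (expR (k * `|x|))%:E).
Proof.
have me : measurable_fun setT (fun x : R => expR (k * `|x|)).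
  by apply: measurableT_comp => //; apply: measurable_funM.
apply/integrableP; split; first exact/measurable_EFinP.
have m1 := measurable_expRM k; have m2 := measurable_expRM (- k).
apply: (@le_lt_trans _ _ (\int[gam]_x ((expR (k * x))%:E + (expR (- k * x))%:E))%E).
  apply: ge0_le_integral; [exact: measurableT|by []| | | ].
  - by apply: measurableT_comp => //; exact/measurable_EFinP.
  - by apply: emeasurable_funD; exact/measurable_EFinP.
  move=> x _; rewrite gee0_abs ?lee_fin ?expR_ge0//.
  case: (ger0P x) => _.
    by rewrite lerDl expR_ge0.
  by rewrite mulrN mulNr lerDr expR_ge0.
rewrite ge0_integralD//; [|exact/measurable_EFinP|exact/measurable_EFinP].
by rewrite !gauss_mgf ltry.
Qed.

Lemma integrable_gauss_dom (f : R -> R) (C k : R) :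
  measurable_fun setT f -> (forall x, `|f x| <= C * expR (k * `|x|)) ->
  gam.-integrable setT (EFin \o f).
Proof.
move=> mf fC.
apply: (@le_integrable _ _ _ gam _ measurableT _ (fun x => C%:E * (expR (k * `|x|))%:E)%E).
- exact/measurable_EFinP.
- by move=> x _ /=; rewrite lee_fin (le_trans (fC x))// ler_norm.
- by apply: integrableZl => //; exact: integrable_gauss_expR.
Qed.

Lemma normr_le_expR (x : R) : `|x| <= expR `|x|.
Proof. by rewrite (le_trans _ (expR_ge1Dx _))// lerDr. Qed.

Lemma integrable_gauss_X (n : nat) :
  gam.-integrable setT (fun x => (x ^+ n)%:E).
Proof.
apply: (@integrable_gauss_dom (fun x => x ^+ n) 1 n%:R) => //.
move=> x; rewrite normrX mul1r mulrC expRM_natr.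
by rewrite lerXn2r ?nnegrE ?expR_ge0// normr_le_expR.
Qed.

Lemma gauss_mean0 : (\int[gam]_x x%:E = 0)%E.
Proof.
have i := integrable_gauss_X 1.
have e : (fun x : R => (x ^+ 1)%:E) = (fun x => x%:E) by apply/funext => x; rewrite expr1.
rewrite e in i; rewrite integralE.
have -> : (\int[gam]_x (fun x => x%:E)^\- x = \int[gam]_x (fun x => x%:E)^\+ x)%E.
  rewrite -[RHS]ge0_integral_gaussN//; last first.
    by apply: measurable_funepos; exact/measurable_EFinP.
  by apply: eq_integral => x _; rewrite !unlock/= EFinN.
by rewrite subee//; exact: integrable_pos_fin_num.
Qed.

End gauss_moments.

(** * Pointwise inequalities *)

Section real_ineq.
Context {R : realType}.

(** Two tangent-line bounds: [1 + v <= expR v] at [v = r * ln t], and [ln t <= t - 1] multiplied by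
    the nonpositive [r]. *)
Lemma powR_ge_bernoulli (r t : R) : r <= 0 -> 0 < t -> 1 + r * (t - 1) <= t `^ r.
Proof.
move=> r0 t0; rewrite /powR gt_eqF// (le_trans _ (expR_ge1Dx _))// lerD2l.
rewrite ler_wnM2l//.
have := @expR_ge1Dx R (ln t); rewrite lnK ?posrE//; lra.
Qed.

(** The condition [0 <= (c - 1) * (t - 1)] places [c] on the same side of 1 as [t], so that both
    orders of 1 and [t] are covered by one statement. *)
Lemma MVT_pos (F dF : R -> R) (t : R) : 0 < t ->
  (forall x : R, 0 < x -> is_derive x (1 : R) F (dF x)) ->
  exists c, [/\ 0 < c, 0 <= (c - 1) * (t - 1) & F t - F 1 = dF c * (t - 1)].
Proof.
move=> t0 dFP.
have cF (x : R) : 0 < x -> {for x, continuous F}.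
  move=> x0; apply: differentiable_continuous; apply/derivable1_diffP.
  by have [] := dFP x x0.
have [t1|t1] := leP 1 t.
  have [||c cI e] := @MVT_segment R F dF 1 t t1.
  - by move=> x; rewrite in_itv/= => /andP[x1 _]; apply: dFP; lra.
  - apply: continuous_in_subspaceT => x; rewrite inE/= in_itv/= => /andP[x1 _].
    by apply: cF; lra.
  move: cI; rewrite in_itv/= => /andP[c1 c2].
  by exists c; split => //; [lra|nra].
have [||c cI e] := @MVT_segment R F dF t 1 (ltW t1).
- by move=> x; rewrite in_itv/= => /andP[x1 _]; apply: dFP; lra.
- apply: continuous_in_subspaceT => x; rewrite inE/= in_itv/= => /andP[x1 _].
  by apply: cF; lra.
move: cI; rewrite in_itv/= => /andP[c1 c2].
by exists c; split => //; [lra|nra|lra].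
Qed.

(** The right side is the cubic Taylor polynomial at 1. It is an upper bound on the whole half-line
    because the fourth derivative of [t^a] is negative, so the later expansions do not ask for small
    increments. *)
Lemma powR_le_cubic (a t : R) : 0 < a -> a < 1 -> 0 < t ->
  t `^ a <= 1 + a * (t - 1) - a * (1 - a) / 2 * (t - 1) ^+ 2
            + a * (1 - a) * (2 - a) / 6 * (t - 1) ^+ 3.
Proof.
move=> a0 a1 t0.
(* [k] is the derivative of the difference [h], divided by [a]. Its own derivative [k'] is
   nonnegative by Bernoulli's inequality, so [k] has the sign of [x - 1] and [h] is least at 1,
   where it vanishes. *)
pose k (x : R) := 1 - (1 - a) * (x - 1) + (1 - a) * (2 - a) / 2 * (x - 1) ^+ 2 - x `^ (a - 1).
pose k' (x : R) := (1 - a) * (-1 + (2 - a) * (x - 1) + x `^ (a - 2)).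
pose h (x : R) := 1 + a * (x - 1) - a * (1 - a) / 2 * (x - 1) ^+ 2
            + a * (1 - a) * (2 - a) / 6 * (x - 1) ^+ 3 - x `^ a.
have dk (x : R) : 0 < x -> is_derive x 1 k (k' x).
  move=> x0; have d := is_derive1_powR (a - 1) x0.
  apply: is_derive_eq.
  rewrite /k' /GRing.scale/= (_ : a - 1 - 1 = a - 2); last by ring.
  by field.
have dh (x : R) : 0 < x -> is_derive x 1 h (a * k x).
  move=> x0; have d := is_derive1_powR a x0.
  apply: is_derive_eq.
  rewrite /k /GRing.scale/=.
  by field.
have k'0 (x : R) : 0 < x -> 0 <= k' x.
  move=> x0; apply: mulr_ge0; first lra.
  have := @powR_ge_bernoulli (a - 2) x _ x0; lra.
have kE (x : R) : 0 < x -> 0 <= k x * (x - 1).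
  move=> x0; have [c [c0 _ e]] := MVT_pos _ _ _ x0 dk.
  have k1 : k 1 = 0 by rewrite /k powR1 subrr; ring.
  move: e; rewrite k1 subr0 => ->.
  by rewrite -mulrA mulr_ge0 ?k'0// -expr2 sqr_ge0.
have [c [c0 cs e]] := MVT_pos _ _ _ t0 dh.
have h1 : h 1 = 0 by rewrite /h powR1 subrr; ring.
suff : 0 <= h t by rewrite /h; lra.
move: e; rewrite h1 subr0 => ->.
rewrite -mulrA mulr_ge0 ?(ltW a0)//.
have := kE c c0.
have [c1|c1|c1] := ltrgtP c 1.
- rewrite nmulr_lge0; last lra. move=> kc.
  by apply: mulr_le0 => //; nra.
- rewrite pmulr_lge0; last lra. move=> kc.
  by apply: mulr_ge0 => //; nra.
- move=> _; suff -> : k c = 0 by rewrite mul0r.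
  by rewrite c1 /k powR1 subrr; ring.
Qed.

End real_ineq.

Section pointwise.
Context {R : realType}.
Implicit Types a b x y S E : R.

(** Three factors are bounded by [S], which will be of order [s], and the remaining ones, at most
    three, by the fixed bound [E]. Thus every monomial beyond the quadratic ones is of third order
    in [s]. *)
Lemma normr_monom_le (x y S E : R) (i j : nat) :
  `|x| <= S -> `|y| <= S -> `|x| <= E -> `|y| <= E -> 1 <= E ->
  (3 <= i + j <= 6)%N -> `|x ^+ i * y ^+ j| <= S ^+ 3 * E ^+ 3.
Proof.
move=> xS yS xE yE E1 /andP[ij3 ij6].
pose m := Num.max `|x| `|y|.
have m0 : 0 <= m by rewrite le_max normr_ge0.
have mS : m <= S by rewrite ge_max xS.
have mE : m <= E by rewrite ge_max xE.
apply: (@le_trans _ _ (m ^+ (i + j))).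
  by rewrite normrM !normrX exprD ler_pM ?exprn_ge0// lerXn2r ?nnegrE// le_max lexx ?orbT.
rewrite -(subnKC ij3) exprD ler_pM ?exprn_ge0//.
  by rewrite lerXn2r ?nnegrE// (le_trans m0).
apply: (@le_trans _ _ (E ^+ (i + j - 3))).
  by rewrite lerXn2r ?nnegrE// (le_trans m0).
by apply: ler_weXn2l => //; rewrite leq_subLR.
Qed.

(** Multiply the two cubic majorants. Beyond the quadratic part there are ten monomials of degree
    three to six with coefficients in [[-1, 1]], hence the factor 10. *)
Lemma powR_prod_le (a b x y S E : R) :
  0 < a -> a < 1 -> 0 < b -> b < 1 -> -1 < x -> -1 < y ->
  `|x| <= S -> `|y| <= S -> `|x| <= E -> `|y| <= E -> 1 <= E ->
  (1 + x) `^ a * (1 + y) `^ b <=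
  1 + a * x + b * y - a * (1 - a) / 2 * x ^+ 2 + a * b * (x * y)
  - b * (1 - b) / 2 * y ^+ 2 + 10 * (S ^+ 3 * E ^+ 3).
Proof.
move=> a0 a1 b0 b1 x1 y1 xS yS xE yE E1.
have := @powR_le_cubic R a (1 + x) a0 a1 ltac:(lra).
have := @powR_le_cubic R b (1 + y) b0 b1 ltac:(lra).
rewrite ![1 + _ - 1]addrC !addKr => hy hx.
apply: (le_trans (ler_pM (powR_ge0 _ _) (powR_ge0 _ _) hx hy)).
set a2 := a * (1 - a) / 2; set b2 := b * (1 - b) / 2.
set a3 := a * (1 - a) * (2 - a) / 6; set b3 := b * (1 - b) * (2 - b) / 6.
have a20 : 0 <= a2 <= 1 by rewrite /a2; apply/andP; split; nra.
have b20 : 0 <= b2 <= 1 by rewrite /b2; apply/andP; split; nra.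
have a30 : 0 <= a3 <= 1.
  have h1 : 0 <= a * (1 - a) <= 1 by apply/andP; split; nra.
  by move: h1; rewrite /a3 => /andP[? ?]; apply/andP; split; nra.
have b30 : 0 <= b3 <= 1.
  have h1 : 0 <= b * (1 - b) <= 1 by apply/andP; split; nra.
  by move: h1; rewrite /b3 => /andP[? ?]; apply/andP; split; nra.
set T := S ^+ 3 * E ^+ 3.
have T0 : 0 <= T by rewrite mulr_ge0 ?exprn_ge0// (le_trans (normr_ge0 x)).
have mon (c : R) i j : 0 <= c <= 1 -> (3 <= i + j <= 6)%N ->
    `|c * (x ^+ i * y ^+ j)| <= T.
  move=> /andP[c0 c1] ij; rewrite normrM ger0_norm//.
  by rewrite (le_trans (ler_piMl _ c1))//; exact: normr_monom_le.
have prod01 (c d : R) : 0 <= c <= 1 -> 0 <= d <= 1 -> 0 <= c * d <= 1.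
  by move=> /andP[? ?] /andP[? ?]; rewrite mulr_ge0//= mulr_ile1.
have a01 : 0 <= a <= 1 by rewrite !ltW.
have b01 : 0 <= b <= 1 by rewrite !ltW.
have := mon a3 3%N 0%N a30 isT; have := mon b3 0%N 3%N b30 isT.
have := mon _ 1%N 2%N (prod01 _ _ a01 b20) isT.
have := mon _ 2%N 1%N (prod01 _ _ a20 b01) isT.
have := mon _ 1%N 3%N (prod01 _ _ a01 b30) isT.
have := mon _ 3%N 1%N (prod01 _ _ a30 b01) isT.
have := mon _ 2%N 2%N (prod01 _ _ a20 b20) isT.
have := mon _ 2%N 3%N (prod01 _ _ a20 b30) isT.
have := mon _ 3%N 2%N (prod01 _ _ a30 b20) isT.
have := mon _ 3%N 3%N (prod01 _ _ a30 b30) isT.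
rewrite !ler_norml !expr0 !expr1 !mul1r !mulr1.
move=> /andP[_ h1] /andP[h2 _] /andP[h3 _] /andP[_ h4] /andP[_ h5] /andP[_ h6]
  /andP[h7 _] /andP[h8 _] /andP[_ h9] /andP[_ h10].
have -> : (1 + a * x - a2 * x ^+ 2 + a3 * x ^+ 3) *
  (1 + b * y - b2 * y ^+ 2 + b3 * y ^+ 3) =
  1 + a * x + b * y - a2 * x ^+ 2 + a * b * (x * y) - b2 * y ^+ 2 +
  (a3 * x ^+ 3 + b3 * y ^+ 3 - a * b2 * (x * y ^+ 2) - a2 * b * (x ^+ 2 * y)
   + a * b3 * (x * y ^+ 3) + a3 * b * (x ^+ 3 * y)
   + a2 * b2 * (x ^+ 2 * y ^+ 2) - a2 * b3 * (x ^+ 2 * y ^+ 3)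
   - a3 * b2 * (x ^+ 3 * y ^+ 2) + a3 * b3 * (x ^+ 3 * y ^+ 3)) by ring.
lra.
Qed.

(** Each increment is a leading term [s p] plus a remainder of order [s^2], and is at most
    [2 s C N], so the higher order terms receive the factor [10 * 2^3 = 80]. Replacing each of the
    three quadratic monomials by its leading part costs at most [3 C^2 s^3 N^3], whence the 9. *)
Lemma powR_prod_expansion (a b s p r p' r' C N E : R) :
  0 < a -> a < 1 -> 0 < b -> b < 1 -> 0 < s -> s <= 1 -> 0 <= C -> 1 <= N ->
  1 <= E ->
  `|p| <= C * N -> `|p'| <= C * N ->
  `|r| <= C * s ^+ 2 * N -> `|r'| <= C * s ^+ 2 * N ->
  -1 < s * p + r -> -1 < s * p' + r' ->
  `|s * p + r| <= E -> `|s * p' + r'| <= E ->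
  (1 + (s * p + r)) `^ a * (1 + (s * p' + r')) `^ b <=
  1 + a * (s * p + r) + b * (s * p' + r') +
  s ^+ 2 * (- (a * (1 - a) / 2 * p ^+ 2) + a * b * (p * p')
            - b * (1 - b) / 2 * p' ^+ 2) +
  (80 * C ^+ 3 * E ^+ 3 + 9 * C ^+ 2) * s ^+ 3 * N ^+ 3.
Proof.
move=> a0 a1 b0 b1 s0 s1 C0 N1 E1 hp hp' hr hr' x1 y1 xE yE.
have N0 : 0 <= N by lra.
have CN : 0 <= C * N by rewrite mulr_ge0.
have ss : s ^+ 2 <= s by rewrite expr2 ler_piMl// ltW.
have rS : C * s ^+ 2 * N <= s * (C * N).
  by rewrite mulrAC mulrC ler_wpM2r.
have bd u v : `|u| <= C * N -> `|v| <= C * s ^+ 2 * N ->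
    `|s * u + v| <= 2 * s * (C * N).
  move=> hu hv; apply: le_trans (ler_normD _ _) _.
  rewrite normrM (gtr0_norm s0).
  have : s * `|u| <= s * (C * N) by rewrite ler_wpM2l// ltW.
  lra.
have := powR_prod_le a b _ _ _ _ a0 a1 b0 b1 x1 y1 (bd _ _ hp hr)
  (bd _ _ hp' hr') xE yE E1.
move/le_trans; apply.
have quad u v u' v' : `|u| <= C * N -> `|v| <= C * s ^+ 2 * N ->
   `|u'| <= C * N -> `|v'| <= C * s ^+ 2 * N ->
   `|(s * u + v) * (s * u' + v') - s ^+ 2 * (u * u')| <= 3 * C ^+ 2 * s ^+ 3 * N ^+ 3.
  move=> hu hv hu' hv'.
  have -> : (s * u + v) * (s * u' + v') - s ^+ 2 * (u * u') =
    s * (u * v') + s * (v * u') + v * v' by ring.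
  have m1 (x y X Y : R) : `|x| <= X -> `|y| <= Y -> `|x * y| <= X * Y.
    by move=> ? ?; rewrite normrM ler_pM.
  have M2 : C ^+ 2 * s ^+ 3 * N ^+ 2 <= C ^+ 2 * s ^+ 3 * N ^+ 3.
    apply: ler_wpM2l; first by rewrite mulr_ge0 ?exprn_ge0// ltW.
    by rewrite [N ^+ 3]exprS ler_peMl ?exprn_ge0.
  have h1 : `|s * (u * v')| <= C ^+ 2 * s ^+ 3 * N ^+ 2.
    rewrite normrM (gtr0_norm s0) (_ : _ * _ * _ = s * ((C * N) * (C * s ^+ 2 * N))); last by ring.
    by rewrite ler_wpM2l ?m1// ltW.
  have h2 : `|s * (v * u')| <= C ^+ 2 * s ^+ 3 * N ^+ 2.
    rewrite normrM (gtr0_norm s0) (_ : _ * _ * _ = s * ((C * s ^+ 2 * N) * (C * N))); last by ring.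
    by rewrite ler_wpM2l ?m1// ltW.
  have h3 : `|v * v'| <= C ^+ 2 * s ^+ 3 * N ^+ 2.
    rewrite (_ : C ^+ 2 * _ * _ = (s * (C * N)) * (C * s ^+ 2 * N)); last by ring.
    by apply: m1 => //; exact: le_trans rS.
  have := ler_normD (s * (u * v') + s * (v * u')) (v * v').
  have := ler_normD (s * (u * v')) (s * (v * u')).
  lra.
have := quad _ _ _ _ hp hr hp hr; have := quad _ _ _ _ hp' hr' hp' hr'.
have := quad _ _ _ _ hp hr hp' hr'.
set T := 3 * C ^+ 2 * s ^+ 3 * N ^+ 3.
have T0 : 0 <= T by rewrite /T !mulr_ge0 ?exprn_ge0// ltW.
rewrite -!expr2.
set X := s * p + r; set Y := s * p' + r'.
set U := X * Y - _; set V := Y ^+ 2 - _; set W := X ^+ 2 - _.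
rewrite !ler_norml => /andP[_ hU] /andP[hV _] /andP[hW _].
have cc (c u : R) : 0 <= c -> c <= 1 -> u <= T -> c * u <= T.
  by move=> ? ? ?; nra.
have k1 : - W * (a * (1 - a) / 2) <= T.
  by rewrite mulrC; apply: cc; [nra|nra|lra].
have k2 : - V * (b * (1 - b) / 2) <= T.
  by rewrite mulrC; apply: cc; [nra|nra|lra].
have k3 : U * (a * b) <= T by rewrite mulrC; apply: cc; [nra|nra|].
have -> : 10 * ((2 * s * (C * N)) ^+ 3 * E ^+ 3) = 80 * C ^+ 3 * E ^+ 3 * s ^+ 3 * N ^+ 3.
  by ring.
have -> : (80 * C ^+ 3 * E ^+ 3 + 9 * C ^+ 2) * s ^+ 3 * N ^+ 3 =
  80 * C ^+ 3 * E ^+ 3 * s ^+ 3 * N ^+ 3 + 3 * T by rewrite /T; ring.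
have -> : X ^+ 2 = W + s ^+ 2 * (p ^+ 2) by rewrite /W; ring.
have -> : Y ^+ 2 = V + s ^+ 2 * (p' ^+ 2) by rewrite /V; ring.
have -> : X * Y = U + s ^+ 2 * (p * p') by rewrite /U; ring.
lra.
Qed.

End pointwise.

(** * One small step *)

Section local_step.
Context d (T : measurableType d) (R : realType) (P : probability T R).

Lemma integrable_bounded (f : T -> R) (M : R) :
  measurable_fun setT f -> (forall t, `|f t| <= M) ->
  P.-integrable setT (EFin \o f).
Proof.
move=> mf fM.
apply: (@le_integrable _ _ _ P _ measurableT _ (EFin \o cst M)).
- exact/measurable_EFinP.
- by move=> t _ /=; rewrite lee_fin (le_trans (fM t))// ler_norm.
- exact: finite_measure_integrable_cst.
Qed.

(** Integrability and value come together so that a long combination can be evaluated by nesting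
    [c * f + g]. *)
Lemma integrable_lin (c : R) (f g : T -> R) :
  P.-integrable setT (EFin \o f) -> P.-integrable setT (EFin \o g) ->
  P.-integrable setT (EFin \o (fun t => c * f t + g t)) /\
  \int[P]_t (c * f t + g t) = c * (\int[P]_t f t) + \int[P]_t g t.
Proof.
move=> fi gi; have cfi : P.-integrable setT (EFin \o (fun t => c * f t)).
  by rewrite (_ : _ \o _ = (fun t => c%:E * (f t)%:E)%E)//; exact: integrableZl.
split; last by rewrite RintegralD// RintegralZl.
by rewrite (_ : _ \o _ = (fun t => (c * f t)%:E + (g t)%:E)%E)//; exact: integrableD.
Qed.

Lemma Rintegral_cst1 (c : R) : \int[P]_t c = c.
Proof.
rewrite Rintegral_cst//.
by rewrite [fine _](_ : _ = 1) ?mulr1//= probability_setT.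
Qed.

Lemma integrable_le (f g : T -> R) :
  measurable_fun setT f -> (forall t, `|f t| <= g t) ->
  P.-integrable setT (EFin \o g) -> P.-integrable setT (EFin \o f).
Proof.
move=> mf fg ig.
apply: (@le_integrable _ _ _ P _ measurableT _ (EFin \o g)) => //.
- exact/measurable_EFinP.
- by move=> t _ /=; rewrite lee_fin (le_trans (fg t))// ler_norm.
Qed.

(** Once a factor [a b] is cancelled, the hypothesis on [rho] says that the discriminant is
    nonpositive. Here the correlation limits the exponents. *)
Lemma quad_form_le0 (a b rho x y : R) :
  0 < a -> a < 1 -> 0 < b -> b < 1 -> rho ^+ 2 * (a * b) <= (1 - a) * (1 - b) ->
  - (a * (1 - a) / 2 * x ^+ 2) + a * b * rho * (x * y)
            - b * (1 - b) / 2 * y ^+ 2 <= 0.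
Proof.
move=> a0 a1 b0 b1 H.
set c1 := a * (1 - a) / 2; set c2 := b * (1 - b) / 2; set c := a * b * rho.
have c10 : 0 < c1 by rewrite /c1 !mulr_gt0//; lra.
have cc : c ^+ 2 <= 4 * c1 * c2.
  have -> : 4 * c1 * c2 = a * b * ((1 - a) * (1 - b)) by rewrite /c1 /c2; field.
  have -> : c ^+ 2 = a * b * (rho ^+ 2 * (a * b)) by rewrite /c; ring.
  by rewrite ler_wpM2l// mulr_ge0// ltW.
rewrite -(pmulr_rle0 _ (_ : 0 < 4 * c1)); last by rewrite mulr_gt0.
have -> : 4 * c1 * (- (c1 * x ^+ 2) + c * (x * y) - c2 * y ^+ 2) =
  - (2 * c1 * x - c * y) ^+ 2 - (4 * c1 * c2 - c ^+ 2) * y ^+ 2 by ring.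
rewrite -opprD oppr_le0 addr_ge0 ?sqr_ge0// mulr_ge0 ?sqr_ge0//.
by rewrite subr_ge0.
Qed.

Variables (X Y : T -> R) (m rho : R).
Hypotheses (mX : measurable_fun setT X) (mY : measurable_fun setT Y).
Hypotheses (iX : P.-integrable setT (EFin \o (fun t => X t ^+ 6)))
           (iY : P.-integrable setT (EFin \o (fun t => Y t ^+ 6))).
Hypotheses (EX : \int[P]_t X t = 0) (EY : \int[P]_t Y t = 0)
  (EX2 : \int[P]_t (X t ^+ 2) = m) (EY2 : \int[P]_t (Y t ^+ 2) = m)
  (EXY : \int[P]_t (X t * Y t) = rho * m).

(** An envelope for the first and second order terms. The error of the expansion carries its cube,
    which explains the sixth moments in the hypotheses. *)
Let N t := 1 + m + X t ^+ 2 + Y t ^+ 2.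

Let m_ge0 : 0 <= m.
Proof. by rewrite -EX2; apply: Rintegral_ge0 => t _; exact: sqr_ge0. Qed.

Let N_ge1 t : 1 <= N t.
Proof. by rewrite /N -!addrA lerDl !addr_ge0 ?sqr_ge0. Qed.

Let le_N3 (x : R) t : x <= N t -> x <= N t ^+ 3.
Proof.
move=> /le_trans; apply; rewrite exprS ler_peMr ?(le_trans _ (N_ge1 t))//.
by rewrite exprn_ege1.
Qed.

Let measurable_N : measurable_fun setT N.
Proof.
apply: measurable_funD; last exact: measurable_funX.
by apply: measurable_funD => //; exact: measurable_funX.
Qed.

Let iN : P.-integrable setT (EFin \o (fun t => N t ^+ 3)).
Proof.
have [i1 _] := integrable_lin 1 _ _ iX iY.
have ic : P.-integrable setT (EFin \o (fun t : T => (1 + m) ^+ 3)).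
  exact: finite_measure_integrable_cst.
have [i2 _] := integrable_lin 1 _ _ ic i1.
have [i3 _] := integrable_lin 27 _ _ i2 (finite_measure_integrable_cst P 0 measurableT).
apply: integrable_le i3; first exact: measurable_funX.
move=> t; rewrite ger0_norm ?exprn_ge0 ?(le_trans _ (N_ge1 t))// addr0.
have cube (u v w : R) : 0 <= u -> 0 <= v -> 0 <= w ->
    (u + v + w) ^+ 3 <= 27 * (1 * u ^+ 3 + (1 * v ^+ 3 + w ^+ 3)).
  move=> u0 v0 w0; pose M := Num.max u (Num.max v w).
  have uM : u <= M by rewrite le_max lexx.
  have vM : v <= M by rewrite !le_max lexx orbT.
  have wM : w <= M by rewrite !le_max lexx !orbT.
  apply: (@le_trans _ _ ((3 * M) ^+ 3)).
    by rewrite lerXn2r ?nnegrE ?addr_ge0//; lra.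
  rewrite (_ : (3 * M) ^+ 3 = 27 * M ^+ 3); last by ring.
  rewrite ler_pM2l// !mul1r.
  have [u3 v3 w3] : [/\ 0 <= u ^+ 3, 0 <= v ^+ 3 & 0 <= w ^+ 3].
    by rewrite !exprn_ge0.
  rewrite /M; case: (leP v w) => _; case: (leP u _) => _; lra.
apply: le_trans (cube _ _ _ _ (sqr_ge0 _) (sqr_ge0 _)) _; first by rewrite addr_ge0.
by rewrite -!exprM.
Qed.

Let XN t : `|X t| <= N t.
Proof.
have := m_ge0; rewrite /N ler_norml; move=> m0.
have := sqr_ge0 (X t - 1); have := sqr_ge0 (X t + 1); have := sqr_ge0 (Y t).
by have := sqr_ge0 (X t); move=> *; apply/andP; split; nra.
Qed.

Let YN t : `|Y t| <= N t.
Proof.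
have := m_ge0; rewrite /N ler_norml; move=> m0.
have := sqr_ge0 (Y t - 1); have := sqr_ge0 (Y t + 1); have := sqr_ge0 (Y t).
by have := sqr_ge0 (X t); move=> *; apply/andP; split; nra.
Qed.

Let X2N t : X t ^+ 2 + m <= N t.
Proof. by have := sqr_ge0 (Y t); rewrite /N; lra. Qed.

Let Y2N t : Y t ^+ 2 + m <= N t.
Proof. by have := sqr_ge0 (X t); rewrite /N; lra. Qed.

Let iX1 : P.-integrable setT (EFin \o X).
Proof. by apply: integrable_le iN => // t; exact: le_N3. Qed.

Let iY1 : P.-integrable setT (EFin \o Y).
Proof. by apply: integrable_le iN => // t; exact: le_N3. Qed.

Let iX2 : P.-integrable setT (EFin \o (fun t => X t ^+ 2)).
Proof.
apply: integrable_le iN => [|t]; first exact: measurable_funX.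
by rewrite ger0_norm ?sqr_ge0//; apply: le_N3; have := X2N t; have := m_ge0; lra.
Qed.

Let iY2 : P.-integrable setT (EFin \o (fun t => Y t ^+ 2)).
Proof.
apply: integrable_le iN => [|t]; first exact: measurable_funX.
by rewrite ger0_norm ?sqr_ge0//; apply: le_N3; have := Y2N t; have := m_ge0; lra.
Qed.

Let iXY : P.-integrable setT (EFin \o (fun t => X t * Y t)).
Proof.
apply: integrable_le iN => [|t]; first exact: measurable_funM.
have XN' : `|X t * Y t| <= X t ^+ 2 + Y t ^+ 2.
  have := sqr_ge0 (X t - Y t); have := sqr_ge0 (X t + Y t).
  have := sqr_ge0 (X t); have := sqr_ge0 (Y t).
  by rewrite ler_norml => *; apply/andP; split; nra.
by apply/le_N3/(le_trans XN'); rewrite /N; have := m_ge0; lra.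
Qed.

(** The increment of [f] is taken relative to the mean [u], not to [f x], so that [al] has mean
    exactly zero and the linear terms vanish on integration. The lower bound [eps] controls the
    division by [u]; the leading part of [al] is [s * (A / u * Z t)]. *)
Lemma increment_le (Z : T -> R) (f : R -> R) (x s A eps M K L : R) :
  measurable_fun setT Z -> P.-integrable setT (EFin \o Z) ->
  P.-integrable setT (EFin \o (fun t => Z t ^+ 2)) ->
  (forall t, Z t ^+ 2 + m <= N t) -> (forall t, `|Z t| <= N t) ->
  \int[P]_t Z t = 0 -> \int[P]_t (Z t ^+ 2) = m ->
  measurable_fun setT f ->
  0 < eps -> 0 <= L -> 0 < s -> (forall z, eps <= f z <= M) -> `|A| <= K ->
  (forall h, `|f (x + h) - f x - A * h| <= L * h ^+ 2) ->
  let u := \int[P]_t f (x + s * Z t) in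
  let al t := (f (x + s * Z t) - u) / u in
  [/\ eps <= u <= M,
     P.-integrable setT (EFin \o al) /\ \int[P]_t al t = 0,
     forall t, -1 < al t /\ `|al t| <= 1 + M / eps,
     forall t, `|A / u * Z t| <= (K + L) / eps * N t &
     forall t, `|al t - s * (A / u * Z t)| <= (K + L) / eps * s ^+ 2 * N t].
Proof.
move=> mZ iZ iZ2 Z2N ZN EZ EZ2 mf e0 L0 s0 fM AK Tf u al.
have mfZ : measurable_fun setT (fun t => f (x + s * Z t)).
  by apply: (measurableT_comp mf); apply: measurable_funD => //; exact: measurable_funM.
have fZ : P.-integrable setT (EFin \o (fun t => f (x + s * Z t))).
  apply: (@integrable_bounded _ M) => // t.
  by have /andP[f1 f2] := fM (x + s * Z t); rewrite ger0_norm//; lra.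
have uM : eps <= u <= M.
  apply/andP; split.
    rewrite -[leLHS]Rintegral_cst1; apply: le_Rintegral => //.
      exact: finite_measure_integrable_cst.
    by move=> t _; have /andP[] := fM (x + s * Z t).
  rewrite -[leRHS]Rintegral_cst1; apply: le_Rintegral => //.
    exact: finite_measure_integrable_cst.
  by move=> t _; have /andP[] := fM (x + s * Z t).
have /andP[u1 u2] := uM.
have u0 : 0 < u by lra.
have alE t : al t = u^-1 * f (x + s * Z t) + - 1.
  by rewrite /al; field; rewrite gt_eqF.
have [ial Eal] := integrable_lin u^-1 _ _ fZ (finite_measure_integrable_cst P (-1) measurableT).
have K0 : 0 <= K by rewrite (le_trans _ AK).
split => //.
- split; first by rewrite (_ : al = (fun t => u^-1 * f (x + s * Z t) + - 1))//; apply/funext.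
  rewrite (_ : al = (fun t => u^-1 * f (x + s * Z t) + - 1)); last exact/funext.
  by rewrite Eal Rintegral_cst1 mulVf ?gt_eqF// subrr.
- move=> t; have /andP[f1 f2] := fM (x + s * Z t); rewrite alE; split.
    by rewrite ltrDr mulr_gt0 ?invr_gt0//; lra.
  apply: le_trans (ler_normD _ _) _; rewrite normrN1 addrC lerD2l.
  rewrite normrM gtr0_norm ?invr_gt0// ger0_norm; last lra.
  rewrite mulrC ler_pdivrMr//.
  rewrite mulrAC ler_pdivlMr// ler_pM//; lra.
- move=> t; rewrite normrM normrM normfV (gtr0_norm u0).
  apply: ler_pM => //.
    by rewrite divr_ge0// ltW.
  by rewrite ler_pM ?invr_ge0 ?(ltW u0)// ?lef_pV2 ?posrE//; lra.
- move=> t.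
  (* Integrating the Taylor bound: the linear term drops out since [Z] has mean zero, so [u] differs
     from [f x] only by order [s^2]. *)
  have fxu : `|f x - u| <= L * s ^+ 2 * m.
    have ii := integrable_lin (s * A) _ _ iZ (finite_measure_integrable_cst P (f x) measurableT).
    have [i1 e1] := ii.
    have [i2 e2] := integrable_lin (-1) _ _ fZ i1.
    have -> : f x - u = \int[P]_t (-1 * f (x + s * Z t) + (s * A * Z t + f x)).
      by rewrite e2 e1 EZ Rintegral_cst1 /u; ring.
    rewrite -EZ2 -RintegralZl//.
    apply: le_trans (le_normr_Rintegral _ _) _ => //.
    apply: le_Rintegral => //.
      by apply: eq_integrable (integrable_abse i2) => // z _.
      have [i3 _] := integrable_lin (L * s ^+ 2) _ _ iZ2 (finite_measure_integrable_cst P 0 measurableT).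
      by move: i3; congr (P.-integrable); apply/funext => z /=; rewrite addr0.
    move=> z _; have := Tf (s * Z z).
    rewrite -normrN exprMn mulrA; congr (_ <= _).
      by congr (`| _ |); ring.
    by rewrite mulrA.
  rewrite [X in `|X|](_ : _ =
     ((f (x + s * Z t) - f x - A * (s * Z t)) + (f x - u)) / u); last first.
    by rewrite /al; field; rewrite gt_eqF.
  have h1 := Tf (s * Z t).
  have h : `|(f (x + s * Z t) - f x - A * (s * Z t)) + (f x - u)| <= L * s ^+ 2 * N t.
    apply: le_trans (ler_normD _ _) _; apply: le_trans (lerD h1 fxu) _.
    by rewrite exprMn mulrA -mulrDr ler_wpM2l // mulr_ge0 ?sqr_ge0.
  rewrite normrM normfV (gtr0_norm u0) ler_pdivrMr//.
  apply: (le_trans h).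
  rewrite [leRHS](_ : _ = ((K + L) * (u / eps)) * (s ^+ 2 * N t)); last first.
    by field; rewrite gt_eqF.
  rewrite -mulrA; apply: ler_wpM2r.
    by rewrite mulr_ge0 ?sqr_ge0// (le_trans _ (N_ge1 t)).
  rewrite -[leLHS]mulr1; apply: ler_pM => //; first lra.
  by rewrite ler_pdivlMr// mul1r.
Qed.

(** After [u^a v^b] is factored out, the linear terms integrate to zero and the quadratic ones to
    [s^2 m] times the form of [quad_form_le0]. [C] is fixed before the step, the points and the
    functions, and sees the latter only through [eps], [M], [K] and [L]. *)
Lemma local_step (a b eps M K L : R) :
  0 < a -> a < 1 -> 0 < b -> b < 1 -> rho ^+ 2 * (a * b) <= (1 - a) * (1 - b) ->
  0 < eps -> eps <= M -> 0 <= L ->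
  exists C, forall (s x y A D : R) (f g : R -> R),
  0 < s -> s <= 1 ->
  measurable_fun setT f -> measurable_fun setT g ->
  (forall z, eps <= f z <= M) -> (forall z, eps <= g z <= M) ->
  `|A| <= K -> `|D| <= K ->
  (forall h, `|f (x + h) - f x - A * h| <= L * h ^+ 2) ->
  (forall h, `|g (y + h) - g y - D * h| <= L * h ^+ 2) ->
  \int[P]_t (f (x + s * X t) `^ a * g (y + s * Y t) `^ b) <=
  (\int[P]_t f (x + s * X t)) `^ a * (\int[P]_t g (y + s * Y t)) `^ b
  + C * s ^+ 3.
Proof.
move=> a0 a1 b0 b1 H e0 eM L0.
pose C0 := (K + L) / eps; pose E := 1 + M / eps.
pose C1 := 80 * C0 ^+ 3 * E ^+ 3 + 9 * C0 ^+ 2.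
pose C2 := C1 * \int[P]_t (N t ^+ 3).
exists (M `^ a * M `^ b * C2) => s x y A D f g s0 s1 mf mg fM gM AK DK Tf Tg.
have := increment_le _ _ _ _ _ _ _ _ _ mX iX1 iX2 X2N XN EX EX2 mf e0 L0 s0 fM AK Tf.
have := increment_le _ _ _ _ _ _ _ _ _ mY iY1 iY2 Y2N YN EY EY2 mg e0 L0 s0 gM DK Tg.
set u := \int[P]_t f (x + s * X t); set v := \int[P]_t g (y + s * Y t).
set al := fun t => (f (x + s * X t) - u) / u.
set be := fun t => (g (y + s * Y t) - v) / v => /=.
move=> [/andP[v1 v2] [ibe Ebe] be1 pbe rbe] [/andP[u1 u2] [ial Eal] al1 pal ral].
have u0 : 0 < u by exact: lt_le_trans u1.
have v0 : 0 < v by exact: lt_le_trans v1.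
have K0 : 0 <= K by rewrite (le_trans _ AK).
have C00 : 0 <= C0 by rewrite divr_ge0 ?addr_ge0// ltW.
have M0 : 0 <= M by exact/ltW/(lt_le_trans e0).
have E1 : 1 <= E by rewrite lerDl divr_ge0// ltW.
have E0 : 0 <= E by exact: le_trans E1.
have C10 : 0 <= C1.
  have h1 : 0 <= C0 ^+ 3 by exact: exprn_ge0.
  have h2 : 0 <= E ^+ 3 by exact: exprn_ge0.
  have h3 : 0 <= C0 ^+ 2 by exact: sqr_ge0.
  by apply: addr_ge0; [apply: mulr_ge0 => //; apply: mulr_ge0|apply: mulr_ge0].
have IN0 : 0 <= \int[P]_t (N t ^+ 3).
  by apply: Rintegral_ge0 => t _; rewrite exprn_ge0// (le_trans _ (N_ge1 t)).
pose A' := A / u; pose D' := D / v.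
(* The bound of [powR_prod_expansion], arranged as nested [c * f + g] for [integrable_lin]. *)
pose F t := a * al t + (b * be t +
   (s ^+ 2 * - (a * (1 - a) / 2 * A' ^+ 2) * (X t ^+ 2) +
   (s ^+ 2 * (a * b * (A' * D')) * (X t * Y t) +
   (s ^+ 2 * - (b * (1 - b) / 2 * D' ^+ 2) * (Y t ^+ 2) +
   (C1 * s ^+ 3 * N t ^+ 3 + 1))))).
have ptw t : f (x + s * X t) `^ a * g (y + s * Y t) `^ b <= u `^ a * v `^ b * F t.
  have [al10 al11] := al1 t; have [be10 be11] := be1 t.
  have fE : f (x + s * X t) = u * (1 + al t) by rewrite /al; field; rewrite gt_eqF.
  have gE : g (y + s * Y t) = v * (1 + be t) by rewrite /be; field; rewrite gt_eqF.
  have ap : 0 <= 1 + al t by rewrite -lerBlDl sub0r ltW.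
  have bp : 0 <= 1 + be t by rewrite -lerBlDl sub0r ltW.
  rewrite fE gE (powRM _ (ltW u0) ap) (powRM _ (ltW v0) bp).
  rewrite mulrACA ler_wpM2l ?mulr_ge0 ?powR_ge0//.
  have alD : s * (A' * X t) + (al t - s * (A' * X t)) = al t by rewrite addrC subrK.
  have beD : s * (D' * Y t) + (be t - s * (D' * Y t)) = be t by rewrite addrC subrK.
  have := @powR_prod_expansion R a b s (A' * X t) (al t - s * (A' * X t))
    (D' * Y t) (be t - s * (D' * Y t)) C0 (N t) E a0 a1 b0 b1 s0 s1 C00 (N_ge1 t)
    E1 (pal t) (pbe t) (ral t) (rbe t).
  rewrite alD beD => /(_ al10 be10 al11 be11) /le_trans; apply.
  by rewrite le_eqVlt; apply/orP; left; apply/eqP; rewrite /F /C1; ring.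
have ic : P.-integrable setT (EFin \o (cst 1 : T -> R)).
  exact: finite_measure_integrable_cst.
have [i1 e1] := integrable_lin (C1 * s ^+ 3) _ _ iN ic.
have [i2 e2] := integrable_lin (s ^+ 2 * - (b * (1 - b) / 2 * D' ^+ 2)) _ _ iY2 i1.
have [i3 e3] := integrable_lin (s ^+ 2 * (a * b * (A' * D'))) _ _ iXY i2.
have [i4 e4] := integrable_lin (s ^+ 2 * - (a * (1 - a) / 2 * A' ^+ 2)) _ _ iX2 i3.
have [i5 e5] := integrable_lin b _ _ ibe i4.
have [i6 e6] := integrable_lin a _ _ ial i5.
have EF : \int[P]_t F t = s ^+ 2 * m * (- (a * (1 - a) / 2 * A' ^+ 2) +
   a * b * rho * (A' * D') - b * (1 - b) / 2 * D' ^+ 2) + C2 * s ^+ 3 + 1.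
  rewrite /F e6 e5 e4 e3 e2 e1 Eal Ebe EX2 EXY EY2 Rintegral_cst1 /C2.
  by ring.
have EF1 : \int[P]_t F t <= C2 * s ^+ 3 + 1.
  rewrite EF -addrA gerDr; apply: mulr_ge0_le0; last exact: quad_form_le0.
  by rewrite mulr_ge0 ?sqr_ge0.
have mfX : measurable_fun setT (fun t => f (x + s * X t)).
  by apply: (measurableT_comp mf); apply: measurable_funD => //; exact: measurable_funM.
have mgY : measurable_fun setT (fun t => g (y + s * Y t)).
  by apply: (measurableT_comp mg); apply: measurable_funD => //; exact: measurable_funM.
apply: (@le_trans _ _ (\int[P]_t (u `^ a * v `^ b * F t))).
  apply: (@le_Rintegral _ _ _ P setT (fun t => f (x + s * X t) `^ a * g (y + s * Y t) `^ b)
    (fun t => u `^ a * v `^ b * F t)) => //.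
    apply: (@integrable_bounded _ (M `^ a * M `^ b)).
      by apply: measurable_funM; exact: (measurableT_comp (measurable_powR _)).
    move=> t; rewrite ger0_norm ?mulr_ge0 ?powR_ge0//.
    have /andP[f1 f2] := fM (x + s * X t); have /andP[g1 g2] := gM (y + s * Y t).
    have f0 := le_trans (ltW e0) f1; have g0 := le_trans (ltW e0) g1.
    by rewrite ler_pM ?powR_ge0// ge0_ler_powR ?nnegrE// ltW.
  rewrite (_ : EFin \o _ = (fun t => (u `^ a * v `^ b)%:E * (F t)%:E)%E)//.
  exact: integrableZl.
rewrite RintegralZl//.
apply: le_trans (ler_wpM2l _ EF1) _; first by rewrite mulr_ge0 ?powR_ge0.
rewrite mulrDr mulr1 addrC lerD2l mulrA ler_wpM2r ?exprn_ge0 ?(ltW s0)//.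
rewrite ler_wpM2r ?mulr_ge0//.
by rewrite ler_pM ?powR_ge0// ge0_ler_powR ?nnegrE// ltW.
Qed.

End local_step.

(** * Gaussian smoothing *)

Section gauss_smooth.
Context {R : realType}.
Local Notation gam := (normal_prob (0 : R) 1).

(** Convolution with the centered Gaussian of variance [c ^+ 2], that is, the transition operator of
    Brownian motion at time [c ^+ 2]. *)
Definition gauss_smooth (c : R) (F : R -> R) (x : R) : R :=
  \int[gam]_y F (x + c * y).

Lemma measurable_affD (x c : R) : measurable_fun setT (fun y : R => x + c * y).
Proof. by apply: measurable_funD => //; exact: measurable_funM. Qed.

Section bounded.
Variables (F : R -> R) (eps M : R).
Hypotheses (mF : measurable_fun setT F) (FM : forall z, eps <= F z <= M)
  (eps0 : 0 <= eps).

Let F0 z : 0 <= F z.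
Proof. by have /andP[/(le_trans eps0)] := FM z. Qed.

Lemma integrable_smooth (c x : R) :
  gam.-integrable setT (EFin \o (fun y => F (x + c * y))).
Proof.
apply: (@integrable_bounded _ _ _ gam _ M).
  by apply: (measurableT_comp mF); exact: measurable_affD.
by move=> t; rewrite ger0_norm//; have /andP[] := FM (x + c * t).
Qed.

Lemma EFin_gauss_smooth (c x : R) :
  (gauss_smooth c F x)%:E = (\int[gam]_y (F (x + c * y))%:E)%E.
Proof. by rewrite /gauss_smooth /Rintegral fineK//; apply: integrable_fin_num => //; exact: integrable_smooth. Qed.

Lemma gauss_smooth_bound (c x : R) : eps <= gauss_smooth c F x <= M.
Proof.
apply/andP; split.
  rewrite -[leLHS](@Rintegral_cst1 _ _ _ gam); apply: le_Rintegral => //.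
  - exact: finite_measure_integrable_cst.
  - exact: integrable_smooth.
  - by move=> t _; have /andP[] := FM (x + c * t).
rewrite -[leRHS](@Rintegral_cst1 _ _ _ gam); apply: le_Rintegral => //.
- exact: integrable_smooth.
- exact: finite_measure_integrable_cst.
- by move=> t _; have /andP[] := FM (x + c * t).
Qed.

Lemma measurable_gauss_smooth (c : R) : measurable_fun setT (gauss_smooth c F).
Proof.
apply/measurable_EFinP.
rewrite (_ : _ \o _ = (fun x => \int[gam]_y (F (x + c * y))%:E)%E); last first.
  by apply/funext => x; rewrite /= EFin_gauss_smooth.
pose k (z : R * R) := (F (z.1 + c * z.2))%:E.
have mk : measurable_fun setT k.
  apply/measurable_EFinP; apply: (measurableT_comp mF).
  by apply: measurable_funD => //; exact: measurable_funM.
by apply: (@measurable_fun_fubini_tonelli_F _ _ _ _ _ gam k mk) => z; rewrite lee_fin.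
Qed.

End bounded.

Lemma gauss_smooth_semigroup (F : R -> R) (M s c : R) :
  measurable_fun setT F -> (forall z, 0 <= F z <= M) -> 0 < s -> 0 < c ->
  gauss_smooth s (gauss_smooth c F) = gauss_smooth (Num.sqrt (c ^+ 2 + s ^+ 2)) F.
Proof.
move=> mF FM s0 c0; apply/funext => x; apply/EFin_inj.
have mS := @measurable_gauss_smooth F 0 M mF FM (lexx _) c.
have bS := @gauss_smooth_bound F 0 M mF FM (lexx _) c.
rewrite (@EFin_gauss_smooth _ 0 M)// (@EFin_gauss_smooth _ 0 M)//.
have q0 : 0 < c ^+ 2 + s ^+ 2 by rewrite addr_gt0 ?exprn_gt0.
have := @ge0_integral_gauss_rot R s c (Num.sqrt (c ^+ 2 + s ^+ 2))
  (fun v => (F (x + v))%:E) s0.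
rewrite sqrtr_gt0 sqr_sqrtr ?(ltW q0)// => /(_ q0); rewrite [s ^+ 2 + _]addrC.
move=> <- //; last 2 first.
- apply/measurable_EFinP; apply: (measurableT_comp mF).
  exact: measurable_funD.
- by move=> v; rewrite lee_fin; have /andP[] := FM (x + v).
apply: eq_integral => y _; rewrite (@EFin_gauss_smooth _ 0 M)//.
by apply: eq_integral => z _; rewrite addrA.
Qed.

Lemma expR_taylor1 (z : R) : `|expR z - 1 - z| <= z ^+ 2 * expR `|z|.
Proof.
have h1 (w : R) : expR w - 1 <= w * expR w.
  have := ler_wpM2l (expR_ge0 w) (expR_ge1Dx (- w)).
  by rewrite -expRD subrr expR0; lra.
have h2 := expR_ge1Dx z.
rewrite ger0_norm; last lra.
have h3 : expR z - 1 - z <= z * (expR z - 1) by have := h1 z; lra.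
apply: (le_trans h3).
have [z0|z0] := ger0P z.
  by rewrite expr2 -mulrA ler_wpM2l.
apply: (@le_trans _ _ (z ^+ 2)).
  by rewrite expr2 ler_wnM2l ?(ltW z0) //; lra.
rewrite -[leLHS]mulr1 ler_wpM2l ?sqr_ge0//.
by have := expR_ge1Dx (- z); lra.
Qed.

(** The weight in the second order remainder of the Cameron-Martin density. For [z = k x - k^2 / 2]
    with [k] at most 1 in absolute value, [z^2] contributes [k^2] and an exponential of rate 2,
    [expR] of its absolute value contributes [expR 1] and an exponential of rate 1, and the leftover
    [k^2 / 2] is absorbed by the summand 1. *)
Let V (x : R) : R := expR 1 * expR (3 * `|x|) + 1.

Let iV : gam.-integrable setT (EFin \o V).
Proof.
have ic : gam.-integrable setT (EFin \o (cst 1 : R -> R)).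
  exact: finite_measure_integrable_cst.
by have [] := @integrable_lin _ _ _ gam (expR 1) _ _ (integrable_gauss_expR 3) ic.
Qed.

Let shift_taylor (k x : R) : `|k| <= 1 ->
  `|expR (k * x - k ^+ 2 / 2) - 1 - k * x| <= k ^+ 2 * V x.
Proof.
move=> k1; set z := k * x - k ^+ 2 / 2.
have -> : expR z - 1 - k * x = (expR z - 1 - z) - k ^+ 2 / 2 by rewrite /z; ring.
apply: le_trans (ler_normB _ _) _.
have zk : `|z| <= `|k| * (`|x| + 1).
  apply: le_trans (ler_normB _ _) _; rewrite normrM mulrDr mulr1 lerD2l.
  rewrite ger0_norm ?divr_ge0 ?sqr_ge0// -real_normK ?num_real//.
  by have := normr_ge0 k; nra.
have x0 := normr_ge0 x; have k0 := normr_ge0 k.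
have h1 : z ^+ 2 <= k ^+ 2 * expR (2 * `|x|).
  rewrite -real_normK ?num_real// -[k ^+ 2]real_normK ?num_real//.
  rewrite mulrC expRM_natl -exprMn mulrC lerXn2r ?nnegrE ?mulr_ge0 ?expR_ge0//.
  by rewrite (le_trans zk)// ler_wpM2l// addrC expR_ge1Dx.
have h2 : expR `|z| <= expR 1 * expR `|x|.
  rewrite -expRD ler_expR (le_trans zk)// addrC.
  by rewrite ler_piMl// addr_ge0.
have h3 : z ^+ 2 * expR `|z| <= k ^+ 2 * (expR 1 * expR (3 * `|x|)).
  apply: (@le_trans _ _ ((k ^+ 2 * expR (2 * `|x|)) * (expR 1 * expR `|x|))).
    by rewrite ler_pM ?sqr_ge0 ?expR_ge0.
  have -> : expR (3 * `|x|) = expR (2 * `|x|) * expR `|x|.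
    by rewrite -expRD; congr expR; ring.
  by rewrite [leRHS](_ : _ = k ^+ 2 * expR (2 * `|x|) * (expR 1 * expR `|x|))//; ring.
rewrite /V mulrDr mulr1 lerD ?(le_trans (expR_taylor1 z))//.
by rewrite ger0_norm ?divr_ge0 ?sqr_ge0//; have := sqr_ge0 k; lra.
Qed.

(** [F] is only bounded and measurable, so the expansion in [h] is carried by the Gaussian density
    through the shift formula. [K] and [L] depend only on [M] and on the lower bound [s] of the
    smoothing level, which is the uniformity needed to iterate. *)
Lemma gauss_smooth_taylor (s M : R) : 0 < s -> 0 <= M ->
  exists K L, 0 <= L /\ forall (F : R -> R) (c x : R),
    measurable_fun setT F -> (forall z, 0 <= F z <= M) -> s <= c ->
    exists A, `|A| <= K /\ forall h,
    `|gauss_smooth c F (x + h) - gauss_smooth c F x - A * h| <= L * h ^+ 2.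
Proof.
move=> s0 M0.
pose I1 := \int[gam]_y `|y|; pose I2 := \int[gam]_y V y.
have V0 y : 0 <= V y by rewrite addr_ge0// mulr_ge0// expR_ge0.
have I10 : 0 <= I1 by apply: Rintegral_ge0.
have I20 : 0 <= I2 by apply: Rintegral_ge0.
have iX : gam.-integrable setT (EFin \o (fun y : R => y)).
  by have := @integrable_gauss_X R 1; apply: eq_integrable.
have iaX : gam.-integrable setT (EFin \o (fun y : R => `|y|)).
  by apply: eq_integrable (integrable_abse iX).
exists (M * I1 / s), (M * (I1 + I2 + 1) / s ^+ 2); split.
  by rewrite divr_ge0 ?sqr_ge0// mulr_ge0// !addr_ge0.
move=> F c x mF FM sc.
have c0 : 0 < c by exact: lt_le_trans sc.
pose H y := F (x + c * y).
have HM y : 0 <= H y <= M by exact: FM.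
have mH : measurable_fun setT H.
  by apply: (measurableT_comp mF); exact: measurable_affD.
have bnd (f g : R -> R) : measurable_fun setT f -> (forall y, `|f y| <= g y) ->
   gam.-integrable setT (EFin \o g) ->
   gam.-integrable setT (EFin \o (fun y => H y * f y)) /\
   `|\int[gam]_y (H y * f y)| <= M * (\int[gam]_y g y).
  move=> mf fg ig.
  have iMg : gam.-integrable setT (EFin \o (fun y => M * g y)).
    by rewrite (_ : _ \o _ = (fun y => M%:E * (g y)%:E)%E)//; exact: integrableZl.
  have Hfg y : `|H y * f y| <= M * g y.
    have /andP[H0 H1] := HM y.
    by rewrite normrM (ger0_norm H0) ler_pM.
  have iHf : gam.-integrable setT (EFin \o (fun y => H y * f y)).
    by apply: integrable_le iMg => //; exact: measurable_funM.
  split => //; apply: le_trans (le_normr_Rintegral _ _) _ => //.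
  rewrite -RintegralZl//; apply: le_Rintegral => //.
  by apply: eq_integrable (integrable_abse iHf).
have [iHX bHX] := bnd (fun y => y) (fun y => `|y|) (ltac:(exact: measurable_id)) (fun=> lexx _) iaX.
(* The derivative of the smoothed function at [x], by Gaussian integration by parts. *)
exists ((\int[gam]_y (H y * y)) / c); split.
  rewrite normrM normfV (gtr0_norm c0) ler_pM ?invr_ge0 ?(ltW c0)//.
  by rewrite lef_pV2 ?posrE.
move=> h; pose k := h / c.
have hE : h = c * k by rewrite /k mulrC divfK// gt_eqF.
have e1 : gauss_smooth c F (x + h) = \int[gam]_y (H y * expR (k * y - k ^+ 2 / 2)).
  rewrite /gauss_smooth /Rintegral; congr fine.
  have := @ge0_integral_gauss_shift R (fun y => (H y)%:E) k.
  rewrite (_ : (\int[gam]_y (H (y + k))%:E = \int[gam]_y (F (x + h + c * y))%:E)%E).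
    move=> ->; first by apply: eq_integral.
      exact/measurable_EFinP.
    by move=> y; rewrite lee_fin; have /andP[] := HM y.
  apply: eq_integral => y _; rewrite /H; congr (F _)%:E; rewrite hE; ring.
have mE : measurable_fun setT (fun y : R => expR (k * y - k ^+ 2 / 2)).
  by apply: measurableT_comp => //; apply: measurable_funB => //; exact: measurable_funM.
have iH : gam.-integrable setT (EFin \o H).
  exact: (@integrable_smooth F 0 M).
have AhE : (\int[gam]_y (H y * y)) / c * h = k * (\int[gam]_y (H y * y)).
  by rewrite /k; field; rewrite gt_eqF.
have h2 : h ^+ 2 = c ^+ 2 * k ^+ 2 by rewrite hE exprMn.
have goalL : M * (I1 + I2 + 1) * k ^+ 2 <= M * (I1 + I2 + 1) / s ^+ 2 * h ^+ 2.
  rewrite h2 mulrA ler_wpM2r ?sqr_ge0// -mulrA -[leLHS]mulr1 ler_wpM2l//.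
    by rewrite mulr_ge0// !addr_ge0.
  rewrite mulrC ler_pdivlMr ?exprn_gt0// mul1r.
  by rewrite lerXn2r ?nnegrE ?(ltW s0)// ltW.
apply: le_trans goalL.
have [k1|k1] := leP `|k| 1.
  have bb mm := bnd (fun y => expR (k * y - k ^+ 2 / 2) - 1 - k * y)
    (fun y => k ^+ 2 * V y) mm (fun y => shift_taylor k y k1).
  have ikV : gam.-integrable setT (EFin \o (fun y => k ^+ 2 * V y)).
    by rewrite (_ : _ \o _ = (fun y => (k ^+ 2)%:E * (V y)%:E)%E)//; exact: integrableZl.
  have [|iT bT] := bb _ ikV.
    apply: measurable_funB; last exact: measurable_funM.
    by apply: measurable_funB.
  have [ia ea] := @integrable_lin _ _ _ gam k _ _ iHX iT.
  have [ib eb] := @integrable_lin _ _ _ gam 1 _ _ iH ia.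
  have -> : gauss_smooth c F (x + h) - gauss_smooth c F x -
     \int[gam]_y (H y * y) / c * h =
     \int[gam]_y (H y * (expR (k * y - k ^+ 2 / 2) - 1 - k * y)).
    rewrite e1 AhE.
    have -> : \int[gam]_y (H y * expR (k * y - k ^+ 2 / 2)) =
       \int[gam]_y (1 * H y + (k * (H y * y) + H y * (expR (k * y - k ^+ 2 / 2) - 1 - k * y))).
      by apply: eq_Rintegral => y _; ring.
    by rewrite eb ea /gauss_smooth -/(H _); rewrite /H; ring.
  apply: (le_trans bT).
  rewrite RintegralZl// -/I2 mulrCA mulrC ler_wpM2r ?sqr_ge0// ler_wpM2l//; lra.
have k2 : `|k| <= k ^+ 2.
  by rewrite -[k ^+ 2]real_normK ?num_real// expr2 ler_peMl// ltW.
have d1 : `|gauss_smooth c F (x + h) - gauss_smooth c F x| <= M.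
  have /andP[? ?] := @gauss_smooth_bound F 0 M mF FM (lexx _) c (x + h).
  have /andP[? ?] := @gauss_smooth_bound F 0 M mF FM (lexx _) c x.
  by rewrite ler_norml; apply/andP; split; lra.
apply: le_trans (ler_normB _ _) _; rewrite AhE normrM.
have d2 : `|k| * `|\int[gam]_y (H y * y)| <= k ^+ 2 * (M * I1) by rewrite ler_pM.
have d3 : M <= M * k ^+ 2 by rewrite ler_peMr// (le_trans _ k2)// ltW.
have d4 : 0 <= M * I2 * k ^+ 2 by apply: mulr_ge0; [exact: mulr_ge0|exact: sqr_ge0].
lra.
Qed.

End gauss_smooth.
Arguments measurable_gauss_smooth {R F eps M}.
Arguments gauss_smooth_bound {R F eps M}.
Arguments gauss_smooth_semigroup {R F M s c}.

(** * Correlated Gaussian pairs *)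

Section law.
Context d (T : measurableType d) {R : realType} (P : probability T R).
Local Notation gam := (normal_prob (0 : R) 1).

(** Equality in law with N(0, 1), tested on nonnegative functions because that is what Tonelli and
    rotation invariance provide; signed functions follow through their positive and negative
    parts. *)
Definition gauss_law (Z : T -> R) : Prop := measurable_fun setT Z /\
  forall f : R -> \bar R, measurable_fun setT f -> (forall x, 0 <= f x)%E ->
  (\int[P]_z f (Z z) = \int[gam]_x f x)%E.

Lemma gauss_law_integral (Z : T -> R) (f : R -> \bar R) : gauss_law Z ->
  measurable_fun setT f -> (\int[P]_z f (Z z) = \int[gam]_x f x)%E.
Proof.
move=> [mZ lZ] mf; rewrite [LHS]integralE [RHS]integralE.
rewrite -lZ//; last exact: measurable_funepos.
rewrite -[X in (_ = _ - X)%E]lZ//; last exact: measurable_funeneg.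
by congr (_ - _)%E; apply: eq_integral => z _; rewrite !unlock.
Qed.

Lemma gauss_law_integrable (Z : T -> R) (f : R -> \bar R) : gauss_law Z ->
  gam.-integrable setT f -> P.-integrable setT (f \o Z).
Proof.
move=> [mZ lZ] /integrableP[mf fi]; apply/integrableP; split.
  exact: measurableT_comp.
rewrite (lZ (fun x => `|f x|)%E)//; exact: measurableT_comp.
Qed.

Lemma gauss_law_Rintegral (Z : T -> R) (f : R -> R) : gauss_law Z ->
  measurable_fun setT f -> \int[P]_z f (Z z) = \int[gam]_x f x.
Proof.
move=> lZ mf; congr fine.
by rewrite (gauss_law_integral Z (EFin \o f) lZ)//; exact/measurable_EFinP.
Qed.

End law.
Arguments gauss_law {d T R}.
Arguments gauss_law_integrable {d T R P Z f}.
Arguments gauss_law_Rintegral {d T R P Z f}.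

Section correlated.
Context {R : realType}.
Local Notation gam := (normal_prob (0 : R) 1).
Local Notation P := ((gam \x gam)%E : probability _ R).
Variables (rho tau : R).
Hypotheses (rho0 : 0 < rho) (rt : rho ^+ 2 + tau ^+ 2 = 1).

(** When [rho ^+ 2 + tau ^+ 2 = 1], the pair [(z.1, corr_snd z)] is standard Gaussian with
    correlation [rho]. Building it from independent coordinates keeps Tonelli available. *)
Definition corr_snd (z : measurableTypeR R * measurableTypeR R) : R :=
  rho * z.1 + tau * z.2.

Lemma measurable_corr_snd : measurable_fun setT corr_snd.
Proof. by apply: measurable_funD; apply: measurable_funM. Qed.

Lemma law_corr_fst : gauss_law P fst.
Proof.
split; first exact: measurable_fst.
move=> f mf f0.
rewrite (@fubini_tonelli1 _ _ _ _ _ gam gam (f \o fst)); last 2 first.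
- exact: measurableT_comp.
- by move=> x /=.
apply: eq_integral => x _; rewrite /fubini_F/= integral_cst//.
by rewrite [X in (_ * X)%E](_ : _ = 1%E) ?mule1//; exact: probability_setT.
Qed.

Lemma law_snd : gauss_law P snd.
Proof.
split; first exact: measurable_snd.
move=> f mf f0.
rewrite (@fubini_tonelli2 _ _ _ _ _ gam gam (f \o snd)); last 2 first.
- exact: measurableT_comp.
- by move=> x /=.
apply: eq_integral => x _; rewrite /fubini_G/= integral_cst//.
by rewrite [X in (_ * X)%E](_ : _ = 1%E) ?mule1//; exact: probability_setT.
Qed.

Lemma law_corr_snd : gauss_law P corr_snd.
Proof.
split; first exact: measurable_corr_snd.
move=> f mf f0.
rewrite (@fubini_tonelli1 _ _ _ _ _ gam gam (f \o corr_snd)); last 2 first.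
- by apply: (measurableT_comp mf); exact: measurable_corr_snd.
- by move=> x /=.
rewrite /fubini_F/= /corr_snd/= (@ge0_integral_gauss_rot R rho tau 1)//; last by rewrite rt expr1n.
by apply: eq_integral => x _; rewrite mul1r.
Qed.

Let m := \int[gam]_x (x ^+ 2).

Let iXP n : gam.-integrable setT (fun x => (x ^+ n)%:E).
Proof. exact: integrable_gauss_X. Qed.

Let id0 : \int[gam]_x x = 0.
Proof. by rewrite /Rintegral gauss_mean0. Qed.

Lemma corr_fst_snd : \int[P]_z (z.1 * corr_snd z) = rho * m.
Proof.
have i1 : P.-integrable setT (EFin \o (fun z => z.1 ^+ 2)).
  exact: (gauss_law_integrable law_corr_fst (iXP 2)).
have i2 : P.-integrable setT (EFin \o (fun z => z.2 ^+ 2)).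
  exact: (gauss_law_integrable law_snd (iXP 2)).
have i12 : P.-integrable setT (EFin \o (fun z : measurableTypeR R * measurableTypeR R => z.1 * z.2)).
  have [i3 _] := @integrable_lin _ _ _ P 1 _ _ i1 i2.
  apply: integrable_le i3; first by apply: measurable_funM.
  move=> z; rewrite mul1r.
  have := sqr_ge0 (z.1 - z.2); have := sqr_ge0 (z.1 + z.2).
  have := sqr_ge0 z.1; have := sqr_ge0 z.2.
  by rewrite ler_norml => *; apply/andP; split; nra.
have e12 : \int[P]_z (z.1 * z.2) = 0.
  rewrite /Rintegral -(integral12_prod_meas1 i12) /fubini_F/=.
  rewrite (eq_integral (cst 0%E)) ?integral0// => x _ /=.
  under eq_integral do rewrite EFinM.
  rewrite integralZl//; last first.
    by have := iXP 1; apply: eq_integrable.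
  by rewrite gauss_mean0 mule0.
have [i4 _] := @integrable_lin _ _ _ P tau _ _ i12 (finite_measure_integrable_cst P 0 measurableT).
have [_ e] := @integrable_lin _ _ _ P rho _ _ i1 i4.
rewrite -[RHS]addr0.
have <- : rho * \int[P]_z (z.1 ^+ 2) + \int[P]_z (tau * (z.1 * z.2) + 0) = rho * m + 0.
  have [_ ->] := @integrable_lin _ _ _ P tau _ _ i12 (finite_measure_integrable_cst P 0 measurableT).
  rewrite e12 Rintegral_cst1 mulr0 !addr0; congr (_ * _).
  by apply: (gauss_law_Rintegral (f:=fun x => x ^+ 2) law_corr_fst); exact: measurable_funX.
rewrite -e; apply: eq_Rintegral => z _; rewrite /corr_snd /=; ring.
Qed.

Lemma corr_local_step (a b eps M K L : R) :
  0 < a -> a < 1 -> 0 < b -> b < 1 -> rho ^+ 2 * (a * b) <= (1 - a) * (1 - b) ->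
  0 < eps -> eps <= M -> 0 <= L ->
  exists C, forall (s x y A D : R) (f g : R -> R),
  0 < s -> s <= 1 ->
  measurable_fun setT f -> measurable_fun setT g ->
  (forall z, eps <= f z <= M) -> (forall z, eps <= g z <= M) ->
  `|A| <= K -> `|D| <= K ->
  (forall h, `|f (x + h) - f x - A * h| <= L * h ^+ 2) ->
  (forall h, `|g (y + h) - g y - D * h| <= L * h ^+ 2) ->
  \int[P]_z (f (x + s * z.1) `^ a * g (y + s * corr_snd z) `^ b) <=
  gauss_smooth s f x `^ a * gauss_smooth s g y `^ b + C * s ^+ 3.
Proof.
move=> a0 a1 b0 b1 H e0 eM L0.
have lX := law_corr_fst; have lY := law_corr_snd.
have mXn n : measurable_fun setT (fun x : R => x ^+ n) by exact: measurable_funX.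
have := @local_step _ _ _ P fst corr_snd m rho measurable_fst measurable_corr_snd
  (gauss_law_integrable lX (iXP 6)) (gauss_law_integrable lY (iXP 6)).
rewrite (gauss_law_Rintegral (f:=id) lX)// (gauss_law_Rintegral (f:=id) lY)//.
rewrite (gauss_law_Rintegral lX (mXn 2%N)) (gauss_law_Rintegral lY (mXn 2%N)).
move=> /(_ id0 id0 erefl erefl corr_fst_snd a b eps M K L a0 a1 b0 b1 H e0 eM L0).
move=> [C HC]; exists C => s x y A D f g s0 s1 mf mg fM gM AK DK Tf Tg.
have := HC s x y A D f g s0 s1 mf mg fM gM AK DK Tf Tg.
rewrite (gauss_law_Rintegral (f:=fun t => f (x + s * t)) lX); last first.
  by apply: (measurableT_comp mf); exact: measurable_affD.
rewrite (gauss_law_Rintegral (f:=fun t => g (y + s * t)) lY)//.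
by apply: (measurableT_comp mg); exact: measurable_affD.
Qed.

(** Two independent steps of size [s] have jointly the law of one step of size [Num.sqrt 2 * s]. In
    the independent coordinates this is rotation invariance, applied once to each. *)
Lemma corr_semigroup (phi : R -> R -> \bar R) (x y s : R) :
  measurable_fun setT (fun z : R * R => phi z.1 z.2) ->
  (forall u v, 0 <= phi u v)%E ->
  (\int[P]_z \int[P]_w phi (x + s * z.1 + s * w.1)%R
                           (y + s * corr_snd z + s * corr_snd w)%R =
   \int[P]_z phi (x + (Num.sqrt 2 * s) * z.1)%R
                 (y + (Num.sqrt 2 * s) * corr_snd z)%R)%E.
Proof.
move=> mphi phi0.
have mphi2 d (T : measurableType d) (f g : T -> R) :
   measurable_fun setT f -> measurable_fun setT g ->
   measurable_fun setT (fun t => phi (f t) (g t)).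
  move=> mf mg; apply: (measurableT_comp mphi (measurable_fun_pair mf mg)).
have q0 : 0 < Num.sqrt 2 :> R by rewrite sqrtr_gt0.
have q2 : Num.sqrt 2 ^+ 2 = 1 ^+ 2 + 1 ^+ 2 :> R.
  by rewrite sqr_sqrtr// expr1n.
have mC := measurable_corr_snd.
have mi d (T : measurableType d) (F : T * (R * R) -> \bar R) :
  measurable_fun setT F -> (forall z, 0 <= F z)%E ->
  measurable_fun setT (fun t => \int[P]_z F (t, z))%E.
  by move=> mF F0; exact: (@measurable_fun_fubini_tonelli_F _ _ _ _ _ P F mF F0).
have mi1 d (T : measurableType d) (F : T * R -> \bar R) :
  measurable_fun setT F -> (forall z, 0 <= F z)%E ->
  measurable_fun setT (fun t => \int[gam]_z F (t, z))%E.
  by move=> mF F0; exact: (@measurable_fun_fubini_tonelli_F _ _ _ _ _ gam F mF F0).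
have tonP (F : R * R -> \bar R) : measurable_fun setT F -> (forall z, 0 <= F z)%E ->
   (\int[P]_z F z = \int[gam]_u \int[gam]_v F (u, v))%E.
  by move=> mF F0; exact: (@fubini_tonelli1 _ _ _ _ _ gam gam F mF F0).
pose G (u v : R) := phi (x + s * u)%R (y + s * (rho * u + tau * v))%R.
have G0 u v : (0 <= G u v)%E by exact: phi0.
have mG d (T : measurableType d) (f g : T -> R) :
   measurable_fun setT f -> measurable_fun setT g ->
   measurable_fun setT (fun t => G (f t) (g t)).
  move=> mf mg; apply: mphi2; apply: measurable_funD => //; apply: measurable_funM => //.
  by apply: measurable_funD; apply: measurable_funM.
have GE z w : phi (x + s * z.1 + s * w.1)%R (y + s * corr_snd z + s * corr_snd w)%R =
    G (z.1 + w.1) (z.2 + w.2).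
  by rewrite /G /corr_snd; congr (phi _ _); ring.
transitivity (\int[P]_z \int[P]_w G (z.1 + w.1)%R (z.2 + w.2)%R)%E.
  by apply: eq_integral => z _; apply: eq_integral => w _; rewrite GE.
(* The four integrals are reordered so that the two first coordinates are adjacent, and likewise the
   two second ones. *)
transitivity (\int[gam]_z1 \int[gam]_w1 \int[gam]_z2 \int[gam]_w2 G (z1 + w1)%R (z2 + w2)%R)%E.
  rewrite tonP; last 2 first.
  - apply: (mi _ _ (fun t : (R * R) * (R * R) => G (t.1.1 + t.2.1) (t.1.2 + t.2.2))) => //.
    by apply: mG; apply: measurable_funD; apply: measurableT_comp.
  - by move=> z; exact: integral_ge0.
  apply: eq_integral => z1 _.
  under eq_integral => z2 _.
    rewrite tonP//=; last by apply: mG; apply: measurable_funD.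
    over.
  rewrite (@fubini_tonelli _ _ _ _ _ gam gam (fun t => \int[gam]_w2 G (z1 + t.2)%R (t.1 + w2)%R)%E); last 2 first.
  - apply: (mi1 _ _ (fun t : (R * R) * R => G (z1 + t.1.2) (t.1.1 + t.2))) => //.
    by apply: mG; apply: measurable_funD => //; apply: measurableT_comp.
  - by move=> z; exact: integral_ge0.
  by [].
have in2 z1 w1 : (\int[gam]_z2 \int[gam]_w2 G (z1 + w1)%R (z2 + w2)%R =
    \int[gam]_v G (z1 + w1)%R (Num.sqrt 2 * v)%R)%E.
  rewrite -(@ge0_integral_gauss_rot R 1 1 (Num.sqrt 2) (G (z1 + w1)) ltr01 q0 q2); last 2 first.
  - exact: mG.
  - by move=> v; exact: G0.
  by under [RHS]eq_integral do under eq_integral do rewrite !mul1r.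
under eq_integral do under eq_integral do rewrite in2.
have := @ge0_integral_gauss_rot R 1 1 (Num.sqrt 2) (fun u => \int[gam]_v G u (Num.sqrt 2 * v)%R)%E ltr01 q0 q2.
move=> /(_ _ _)/= e.
transitivity (\int[gam]_x0 \int[gam]_y0 \int[gam]_v G (1 * x0 + 1 * y0)%R (Num.sqrt 2 * v)%R)%E.
  by apply: eq_integral => u _; apply: eq_integral => v _; rewrite !mul1r.
rewrite e; last 2 first.
- apply: (mi1 _ _ (fun t : R * R => G t.1 (Num.sqrt 2 * t.2))) => //.
  by apply: mG => //; apply: measurable_funM.
- by move=> u; exact: integral_ge0.
rewrite [RHS]tonP; last 2 first.
- apply: mphi2; apply: measurable_funD => //; exact: measurable_funM.
- by move=> z; exact: phi0.
apply: eq_integral => u _; apply: eq_integral => v _.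
by rewrite /G /corr_snd/=; congr (phi _ _); ring.
Qed.

End correlated.

(** * Doubling the step *)

Section smooth_bilinear.
Context {R : realType}.
Local Notation gam := (normal_prob (0 : R) 1).
Local Notation P := ((gam \x gam)%E : probability _ R).
Variables (rho tau a b : R).
Hypotheses (rho0 : 0 < rho) (rt : rho ^+ 2 + tau ^+ 2 = 1).
Hypotheses (a0 : 0 < a) (a1 : a < 1) (b0 : 0 < b) (b1 : b < 1)
  (rab : rho ^+ 2 * (a * b) <= (1 - a) * (1 - b)).
Local Notation Y := (corr_snd rho tau).

Lemma measurable_powR_prod d (T : measurableType d) (f g : T -> R) :
  measurable_fun setT f -> measurable_fun setT g ->
  measurable_fun setT (fun t => (f t `^ a * g t `^ b)%:E).
Proof.
by move=> mf mg; apply/measurable_EFinP; apply: measurable_funM;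
  exact: (measurableT_comp (measurable_powR _)).
Qed.

Section doubling.
Variables (F G : R -> R) (eps M c0 : R).
Hypotheses (mF : measurable_fun setT F) (mG : measurable_fun setT G)
  (FM : forall z, eps <= F z <= M) (GM : forall z, eps <= G z <= M)
  (eps0 : 0 < eps) (c00 : 0 < c0).

Let F0M z : 0 <= F z <= M.
Proof. by have /andP[/(le_trans (ltW eps0)) -> ->] := FM z. Qed.

Let G0M z : 0 <= G z <= M.
Proof. by have /andP[/(le_trans (ltW eps0)) -> ->] := GM z. Qed.

(** Uniform over all levels above [c0], because a step turns the level [c] into
    [Num.sqrt (c ^+ 2 + s ^+ 2)] and the bound is then needed at that level. *)
Definition step_bound (s e : R) := forall c c' x y, c0 <= c -> c0 <= c' ->
  (\int[P]_z (gauss_smooth c F (x + s * z.1) `^ a *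
              gauss_smooth c' G (y + s * Y z) `^ b)%:E <=
   (gauss_smooth (Num.sqrt (c ^+ 2 + s ^+ 2)) F x `^ a *
    gauss_smooth (Num.sqrt (c' ^+ 2 + s ^+ 2)) G y `^ b + e)%:E)%E.

Let mS c := measurable_gauss_smooth mF FM (ltW eps0) c.
Let mS' c := measurable_gauss_smooth mG GM (ltW eps0) c.

(** Condition on the first step: the bound is used at the levels [c], [c'] for the second step and
    at the increased levels for the first. The error is a constant and [P] has mass 1, so the two
    errors add. *)
Lemma step_bound_double (s e : R) : 0 <= e -> step_bound s e ->
  step_bound (Num.sqrt 2 * s) (2 * e).
Proof.
move=> e0 H c c' x y cc cc'.
pose phi u v := (gauss_smooth c F u `^ a * gauss_smooth c' G v `^ b)%:E.
have phi0 u v : (0 <= phi u v)%E by rewrite lee_fin mulr_ge0// powR_ge0.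
have mphi : measurable_fun setT (fun z : R * R => phi z.1 z.2).
  by apply: measurable_powR_prod; apply: measurableT_comp.
rewrite -(corr_semigroup rho tau _ x y s mphi phi0).
have sqE (u : R) : c0 <= u -> c0 <= Num.sqrt (u ^+ 2 + s ^+ 2).
  move=> cu; apply: (le_trans cu).
  rewrite -[leLHS]ger0_norm ?(le_trans (ltW c00) cu)// -sqrtr_sqr ler_sqrt ?addr_ge0 ?sqr_ge0//.
  by rewrite lerDl sqr_ge0.
have sq2 (u : R) : Num.sqrt (Num.sqrt (u ^+ 2 + s ^+ 2) ^+ 2 + s ^+ 2) =
    Num.sqrt (u ^+ 2 + (Num.sqrt 2 * s) ^+ 2).
  rewrite sqr_sqrtr ?addr_ge0 ?sqr_ge0// exprMn sqr_sqrtr//.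
  by congr Num.sqrt; ring.
have := H _ _ x y (sqE _ cc) (sqE _ cc'); rewrite !sq2 => H2.
have mJ (u v : R) : measurable_fun setT (fun z : R * R =>
     (gauss_smooth (Num.sqrt (c ^+ 2 + s ^+ 2)) F (x + s * z.1) `^ a *
              gauss_smooth (Num.sqrt (c' ^+ 2 + s ^+ 2)) G (y + s * Y z) `^ b)%:E).
  apply: measurable_powR_prod.
    apply: (measurableT_comp (mS _)); apply: measurable_funD => //; exact: measurable_funM.
  apply: (measurableT_comp (mS' _)); apply: measurable_funD => //; apply: measurable_funM => //.
  exact: measurable_corr_snd.
pose Q := (measurableTypeR R * measurableTypeR R)%type.
have m1 (u : R) (h k : Q * Q -> R) : measurable_fun setT h -> measurable_fun setT k ->
    measurable_fun setT (fun t => u + s * h t + s * k t).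
  move=> mh mk; apply: measurable_funD; first apply: measurable_funD.
  - exact: measurable_cst.
  - apply: measurable_funM => //; exact: measurable_cst.
  - apply: measurable_funM => //; exact: measurable_cst.
have mC := @measurable_corr_snd R rho tau.
have mK : measurable_fun setT (fun t : Q * Q =>
    phi (x + s * t.1.1 + s * t.2.1) (y + s * Y t.1 + s * Y t.2)).
  apply: measurable_powR_prod.
    apply: (measurableT_comp (mS c)); apply: m1.
      exact: (measurableT_comp measurable_fst measurable_fst).
    exact: (measurableT_comp measurable_fst measurable_snd).
  apply: (measurableT_comp (mS' c')); apply: m1.
    exact: (measurableT_comp mC measurable_fst).
  exact: (measurableT_comp mC measurable_snd).
apply: (@le_trans _ _ (\int[P]_z ((gauss_smooth (Num.sqrt (c ^+ 2 + s ^+ 2)) F (x + s * z.1) `^ a *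
              gauss_smooth (Num.sqrt (c' ^+ 2 + s ^+ 2)) G (y + s * Y z) `^ b)%:E + e%:E))%E).
  apply: ge0_le_integral; first exact: measurableT.
  - by move=> z _; apply: integral_ge0 => w _; exact: phi0.
  - exact: (@measurable_fun_fubini_tonelli_F _ _ _ _ _ P _ mK (fun t => phi0 _ _)).
  - by apply: emeasurable_funD; [exact: mJ|exact: measurable_cst].
  - by move=> z _; rewrite -EFinD; exact: H.
rewrite ge0_integralD; last 5 first.
- exact: measurableT.
- by move=> z _; rewrite lee_fin mulr_ge0// powR_ge0.
- exact: mJ.
- by move=> z _; rewrite lee_fin.
- exact: measurable_cst.
rewrite integral_cst// [X in (_ * X)%E](_ : _ = 1%E) ?mule1; last exact: probability_setT.
by apply: (le_trans (leeD2r _ H2)); rewrite -EFinD lee_fin -addrA -mulr2n mulr_natl.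
Qed.

Lemma step_bound_iter n (s e : R) : 0 <= e -> step_bound s e ->
  step_bound (Num.sqrt 2 ^+ n * s) (2 ^+ n * e).
Proof.
move=> e0 H; elim: n => [|n IH]; first by rewrite !mul1r.
rewrite !exprS -!mulrA; apply: step_bound_double => //.
by rewrite mulr_ge0// exprn_ge0.
Qed.

Lemma step_bound_base : exists C, forall s, 0 < s -> s <= 1 ->
  step_bound s (C * s ^+ 3).
Proof.
have eM : eps <= M by have /andP[/le_trans + ?] := FM 0; exact.
have M0 : 0 <= M by exact: le_trans (ltW eps0) eM.
have [K [L [L0 T]]] := @gauss_smooth_taylor R c0 M c00 M0.
have [C HC] := @corr_local_step R rho tau rho0 rt a b eps M K L a0 a1 b0 b1 rab eps0 eM L0.
exists C => s s0 s1 c c' x y cc cc'.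
have [A [AK TA]] := T F c x mF F0M cc.
have [D [DK TD]] := T G c' y mG G0M cc'.
have bF := gauss_smooth_bound mF FM (ltW eps0) c.
have bG := gauss_smooth_bound mG GM (ltW eps0) c'.
have := HC s x y A D _ _ s0 s1 (mS c) (mS' c') bF bG AK DK TA TD.
rewrite (gauss_smooth_semigroup mF F0M s0 (lt_le_trans c00 cc)).
rewrite (gauss_smooth_semigroup mG G0M s0 (lt_le_trans c00 cc')).
rewrite -lee_fin; apply: le_trans; rewrite /Rintegral fineK//.
apply: integrable_fin_num => //.
apply: (@integrable_bounded _ _ _ P _ (M `^ a * M `^ b)).
  apply/measurable_EFinP; apply: measurable_powR_prod.
    apply: (measurableT_comp (mS _)); apply: measurable_funD => //; exact: measurable_funM.
  apply: (measurableT_comp (mS' _)); apply: measurable_funD => //; apply: measurable_funM => //.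
  exact: measurable_corr_snd.
move=> t; rewrite ger0_norm ?mulr_ge0 ?powR_ge0//.
have /andP[f1 f2] := bF (x + s * t.1); have /andP[g1 g2] := bG (y + s * Y t).
have f0 := le_trans (ltW eps0) f1; have g0 := le_trans (ltW eps0) g1.
by rewrite ler_pM ?powR_ge0// ge0_ler_powR ?nnegrE// ltW.
Qed.

Lemma step_bound_one : step_bound 1 0.
Proof.
have [C HC] := step_bound_base.
have q0 : 0 < Num.sqrt 2 :> R by rewrite sqrtr_gt0.
have q1 : 1 < Num.sqrt 2 :> R by rewrite -[ltLHS]sqrtr1 ltr_sqrt// ltr1n.
have q2 : Num.sqrt 2 ^+ 2 = 2 :> R by rewrite sqr_sqrtr.
(* Iteration asks for a nonnegative error, whereas the sign of [C] is unknown. *)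
pose C' := Num.max 0 C.
have C'0 : 0 <= C' by rewrite le_max lexx.
have CC' : C <= C' by rewrite le_max lexx orbT.
have H n : step_bound 1 (C' * (Num.sqrt 2)^-1 ^+ n).
  have s0 : 0 < (Num.sqrt 2)^-1 ^+ n :> R by rewrite exprn_gt0// invr_gt0.
  have s1 : (Num.sqrt 2)^-1 ^+ n <= 1 :> R.
    by rewrite exprn_ile1 ?invr_ge0 ?(ltW q0)// invf_le1// ltW.
  have h0 : 0 <= C' * ((Num.sqrt 2)^-1 ^+ n) ^+ 3 by rewrite mulr_ge0// exprn_ge0// ltW.
  have := @step_bound_iter n ((Num.sqrt 2)^-1 ^+ n) (C' * ((Num.sqrt 2)^-1 ^+ n) ^+ 3) h0.
  rewrite -exprMn mulfV ?gt_eqF// expr1n.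
  have -> : 2 ^+ n * (C' * ((Num.sqrt 2)^-1 ^+ n) ^+ 3) = C' * (Num.sqrt 2)^-1 ^+ n :> R.
    have w2 : 2 ^+ n * ((Num.sqrt 2)^-1 ^+ n) ^+ 2 = 1 :> R.
      by rewrite -exprM mulnC exprM exprVn q2 -exprMn mulfV ?expr1n.
    by rewrite [_ ^+ 3]exprS mulrCA [2 ^+ n * _]mulrCA w2 mulr1.
  apply=> c c' x y cc cc'; apply: le_trans (HC _ s0 s1 _ _ _ _ cc cc') _.
  by rewrite lee_fin lerD2l ler_wpM2r// exprn_ge0// ltW.
move=> c c' x y cc cc'; rewrite addr0.
apply/lee_addgt0Pr => e e0.
have : C' * (Num.sqrt 2)^-1 ^+ n @[n --> \oo] --> C' * 0.
  apply: cvgMr; apply: cvg_expr.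
  by rewrite ger0_norm ?invr_ge0 ?(ltW q0)// invf_lt1.
rewrite mulr0 => /cvgrPdist_lt/(_ e e0)[N _ /(_ N (leqnn _))]/=.
rewrite sub0r normrN => hN.
apply: le_trans (H N _ _ x y cc cc') _.
rewrite -EFinD lee_fin lerD2l; apply: ltW; apply: le_lt_trans hN; exact: ler_norm.
Qed.

Lemma smooth_bilinear (c : R) : c0 <= c ->
  (\int[P]_z (gauss_smooth c F z.1 `^ a * gauss_smooth c G (Y z) `^ b)%:E <=
   (gauss_smooth (Num.sqrt (c ^+ 2 + 1)) F 0 `^ a *
    gauss_smooth (Num.sqrt (c ^+ 2 + 1)) G 0 `^ b)%:E)%E.
Proof.
move=> cc; have := step_bound_one c c 0 0 cc cc; rewrite addr0 expr1n.
apply: le_trans; rewrite le_eqVlt; apply/orP; left; apply/eqP.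
by apply: eq_integral => z _; rewrite !add0r !mul1r.
Qed.

End doubling.

End smooth_bilinear.

(** * From smoothed to bounded functions *)

Section powR_limits.
Context {R : realType}.

Lemma cvg_powR_at (a x : R) : 0 < x ->
  (y `^ a) @[y --> x] --> x `^ a.
Proof.
move=> x0; suff : {for x, continuous (fun y : R => y `^ a)} by [].
apply: differentiable_continuous; apply/derivable1_diffP.
by have [] := is_derive1_powR a x0.
Qed.

Lemma cvg_powR_right (a x : R) : 0 < a -> 0 <= x ->
  ((x + e) `^ a) @[e --> 0^'+] --> x `^ a.
Proof.
move=> a0; rewrite le_eqVlt => /predU1P[<-|x0].
  under eq_fun do rewrite add0r.
  by rewrite powR0 ?gt_eqF//; exact: powR_cvg0.
have h : x + e @[e --> 0^'+] --> x + 0.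
  by apply: cvgD; [exact: cvg_cst|exact: cvg_at_right_filter].
rewrite addr0 in h.
apply: (cvg_comp _ (fun y => y `^ a) h).
exact: (@cvg_powR_at a x x0).
Qed.

(** Serves twice: to remove the constant added for positivity, and to remove the excess of the outer
    approximations. *)
Lemma powR_prod_lim (a b x y : R) (z : \bar R) : 0 < a -> 0 < b -> 0 <= x -> 0 <= y ->
  (forall e, 0 < e -> (z <= ((x + e) `^ a * (y + e) `^ b)%:E)%E) ->
  (z <= (x `^ a * y `^ b)%:E)%E.
Proof.
move=> a0 b0 x0 y0 H.
have c : ((x + e) `^ a * (y + e) `^ b)%:E @[e --> 0^'+] --> (x `^ a * y `^ b)%:E.
  by apply: cvg_EFin; [exact: nearW|apply: cvgM; exact: cvg_powR_right].
apply: cvge_ge c; near=> e; apply: H.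
by near: e; exact: nbhs_right_gt.
Unshelve. all: by end_near. Qed.

(** The bounds make the sequence constant when [x = 0], so continuity of the power is needed only at
    positive points. *)
Lemma cvg_powR_below (a x : R) (u : R^nat) : 0 < a ->
  (forall n, 0 <= u n <= x) -> u n @[n --> \oo] --> x ->
  (u n `^ a) @[n --> \oo] --> x `^ a.
Proof.
move=> a0 ux uc.
have [x0|x0] := leP x 0.
  have ue n : u n = x.
    have /andP[u1 u2] := ux n; apply/le_anti; rewrite u2/=.
    exact: le_trans x0 u1.
  by under eq_fun do rewrite ue; exact: cvg_cst.
apply: (cvg_comp _ (fun y => y `^ a) uc).
exact: (@cvg_powR_at a x x0).
Qed.

End powR_limits.

Section extension.
Context {R : realType}.
Local Notation gam := (normal_prob (0 : R) 1).
Local Notation P := ((gam \x gam)%E : probability _ R).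
Variables (rho tau a b : R).
Hypotheses (rho0 : 0 < rho) (rt : rho ^+ 2 + tau ^+ 2 = 1).
Hypotheses (a0 : 0 < a) (a1 : a < 1) (b0 : 0 < b) (b1 : b < 1)
  (rab : rho ^+ 2 * (a * b) <= (1 - a) * (1 - b)).
Local Notation Y := (corr_snd rho tau).

Definition gauss_form (F G : R -> R) : \bar R :=
  (\int[P]_z (F z.1 `^ a * G (Y z) `^ b)%:E)%E.

Lemma measurable_gauss_form (F G : R -> R) :
  measurable_fun setT F -> measurable_fun setT G ->
  measurable_fun setT (fun z : measurableTypeR R * measurableTypeR R =>
    (F z.1 `^ a * G (Y z) `^ b)%:E).
Proof.
move=> mF mG; apply: measurable_powR_prod.
  exact: (measurableT_comp mF measurable_fst).
exact: (measurableT_comp mG (@measurable_corr_snd R rho tau)).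
Qed.

Lemma le_gauss_form (F G F' G' : R -> R) :
  measurable_fun setT F -> measurable_fun setT G ->
  measurable_fun setT F' -> measurable_fun setT G' ->
  (forall x, 0 <= F x <= F' x) -> (forall x, 0 <= G x <= G' x) ->
  (gauss_form F G <= gauss_form F' G')%E.
Proof.
move=> mF mG mF' mG' FF' GG'; apply: ge0_le_integral; first exact: measurableT.
- by move=> z _; rewrite lee_fin mulr_ge0// powR_ge0.
- exact: measurable_gauss_form.
- exact: measurable_gauss_form.
move=> z _; rewrite lee_fin.
have /andP[f1 f2] := FF' z.1; have /andP[g1 g2] := GG' (Y z).
have f3 := le_trans f1 f2; have g3 := le_trans g1 g2.
by rewrite ler_pM ?powR_ge0// ge0_ler_powR ?nnegrE// ltW.
Qed.

(** For [r ^+ 2 + s ^+ 2 = 1], the one-dimensional Ornstein-Uhlenbeck operator. Plain smoothing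
    enlarges the variance; the contraction by [r] compensates, so that Gaussian integrals are
    preserved. *)
Definition ou1 (r s : R) (F : R -> R) (x : R) : R := \int[gam]_y F (r * x + s * y).

Lemma ou1_smooth (r s : R) (F : R -> R) : 0 < r ->
  ou1 r s F = gauss_smooth (s / r) (fun x => F (r * x)).
Proof.
move=> r0; apply/funext => x; apply: eq_Rintegral => y _; congr F.
by rewrite mulrDr mulrA; congr (_ + _ * _); field; rewrite gt_eqF.
Qed.

Lemma gauss_form_ou1_pos (r s eps M : R) (F G : R -> R) :
  0 < r -> 0 < s -> r ^+ 2 + s ^+ 2 = 1 -> 0 < eps ->
  measurable_fun setT F -> measurable_fun setT G ->
  (forall x, eps <= F x <= M) -> (forall x, eps <= G x <= M) ->
  (gauss_form (ou1 r s F) (ou1 r s G) <=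
   ((\int[gam]_x F x) `^ a * (\int[gam]_x G x) `^ b)%:E)%E.
Proof.
move=> r0 s0 rs e0 mF mG FM GM.
have sr0 : 0 < s / r by rewrite divr_gt0.
have mr (H : R -> R) : measurable_fun setT H -> measurable_fun setT (fun x => H (r * x)).
  by move=> mH; apply: (measurableT_comp mH); exact: measurable_funM.
have := @smooth_bilinear R rho tau a b rho0 rt a0 a1 b0 b1 rab
  _ _ eps M (s / r) (mr _ mF) (mr _ mG) (fun x => FM _) (fun x => GM _) e0 sr0
  (s / r) (lexx _).
rewrite (ou1_smooth r s F r0) (ou1_smooth r s G r0) => h; apply: (le_trans h) => {h}.
(* Level [s / r] followed by a unit step gives level [1 / r], which cancels the dilation by [r]: the
   right side, taken at 0, becomes the plain Gaussian integral. *)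
have q : Num.sqrt ((s / r) ^+ 2 + 1) = r^-1.
  have -> : (s / r) ^+ 2 + 1 = r^-1 ^+ 2.
    rewrite (_ : _ + 1 = (r ^+ 2 + s ^+ 2) / r ^+ 2); last by field; rewrite gt_eqF.
    by rewrite rs div1r exprVn.
  by rewrite sqrtr_sqr ger0_norm// invr_ge0 ltW.
have e (H : R -> R) : gauss_smooth r^-1 (fun x => H (r * x)) 0 = \int[gam]_x H x.
  apply: eq_Rintegral => x _; congr H.
  by rewrite add0r mulrA mulfV ?mul1r// gt_eqF.
by rewrite q !e.
Qed.

Lemma integrable_gauss_bounded (F : R -> R) (M : R) : measurable_fun setT F ->
  (forall x, 0 <= F x <= M) -> gam.-integrable setT (EFin \o F).
Proof.
move=> mF FM; apply: (@integrable_bounded _ _ _ gam _ M) => // x.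
by have /andP[f0 f1] := FM x; rewrite ger0_norm.
Qed.

Lemma measurable_ou1 (r s M : R) (F : R -> R) : 0 < r -> measurable_fun setT F ->
  (forall x, 0 <= F x <= M) -> measurable_fun setT (ou1 r s F).
Proof.
move=> r0 mF FM; rewrite ou1_smooth//.
apply: (@measurable_gauss_smooth R _ 0 M) => //.
by apply: (measurableT_comp mF); exact: measurable_funM.
Qed.

Lemma ou1_bound (r s M : R) (F : R -> R) x : 0 < r -> measurable_fun setT F ->
  (forall x, 0 <= F x <= M) -> 0 <= ou1 r s F x <= M.
Proof.
move=> r0 mF FM; rewrite ou1_smooth//.
apply: (@gauss_smooth_bound R _ 0 M) => //.
by apply: (measurableT_comp mF); exact: measurable_funM.
Qed.

Lemma integrable_ou1 (r s M x : R) (F : R -> R) : measurable_fun setT F ->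
  (forall x, 0 <= F x <= M) ->
  gam.-integrable setT (EFin \o (fun y => F (r * x + s * y))).
Proof.
move=> mF FM; apply: (@integrable_gauss_bounded _ M) => //.
by apply: (measurableT_comp mF); exact: measurable_affD.
Qed.

Lemma gauss_form_ou1 (r s M : R) (F G : R -> R) :
  0 < r -> 0 < s -> r ^+ 2 + s ^+ 2 = 1 ->
  measurable_fun setT F -> measurable_fun setT G ->
  (forall x, 0 <= F x <= M) -> (forall x, 0 <= G x <= M) ->
  (gauss_form (ou1 r s F) (ou1 r s G) <=
   ((\int[gam]_x F x) `^ a * (\int[gam]_x G x) `^ b)%:E)%E.
Proof.
move=> r0 s0 rs mF mG FM GM.
have i0 (H : R -> R) : (forall x, 0 <= H x <= M) -> 0 <= \int[gam]_x H x.
  by move=> HM; apply: Rintegral_ge0 => x _; have /andP[] := HM x.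
(* Both functions are raised by [e] to be bounded away from 0; [ou1] and the Gaussian integral
   commute with adding a constant. *)
apply: powR_prod_lim => //; [exact: i0|exact: i0|move=> e e0].
have me (H : R -> R) : measurable_fun setT H -> measurable_fun setT (fun x => H x + e).
  by move=> mH; apply: measurable_funD.
have be (H : R -> R) : (forall x, 0 <= H x <= M) -> forall x, e <= H x + e <= M + e.
  by move=> HM x; have /andP[h0 h1] := HM x; rewrite lerD2r h1 lerDr h0.
have be0 (H : R -> R) : (forall x, 0 <= H x <= M) -> forall x, 0 <= H x + e <= M + e.
  by move=> /be he x; have /andP[/(le_trans (ltW e0)) -> ->] := he x.
have ie (H : R -> R) : gam.-integrable setT (EFin \o H) ->
    \int[gam]_x (H x + e) = \int[gam]_x H x + e.
  move=> iH; rewrite RintegralD//; last exact: finite_measure_integrable_cst.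
  by rewrite Rintegral_cst1.
have := @gauss_form_ou1_pos r s e (M + e) _ _ r0 s0 rs e0 (me _ mF) (me _ mG) (be _ FM) (be _ GM).
rewrite !ie; [|exact: integrable_gauss_bounded mG GM|exact: integrable_gauss_bounded mF FM].
apply: le_trans; apply: le_gauss_form.
- exact: measurable_ou1 mF FM.
- exact: measurable_ou1 mG GM.
- exact: measurable_ou1 (me _ mF) (be0 _ FM).
- exact: measurable_ou1 (me _ mG) (be0 _ GM).
- move=> x; have /andP[-> _]/= := @ou1_bound r s M F x r0 mF FM.
  rewrite {2}/ou1 ie; last exact: integrable_ou1 mF FM.
  by rewrite lerDl ltW.
- move=> x; have /andP[-> _]/= := @ou1_bound r s M G x r0 mG GM.
  rewrite {2}/ou1 ie; last exact: integrable_ou1 mG GM.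
  by rewrite lerDl ltW.
Qed.

Lemma gauss_form_below_limit (F G : R -> R) (Fn Gn : nat -> R -> R) (M : R) (c : \bar R) :
  (forall n, measurable_fun setT (Fn n)) -> (forall n, measurable_fun setT (Gn n)) ->
  (forall n x, 0 <= Fn n x <= F x) -> (forall n x, 0 <= Gn n x <= G x) ->
  (forall x, F x <= M) -> (forall x, G x <= M) ->
  (forall x, Fn n x @[n --> \oo] --> F x) -> (forall x, Gn n x @[n --> \oo] --> G x) ->
  (forall n, gauss_form (Fn n) (Gn n) <= c)%E ->
  (gauss_form F G <= c)%E.
Proof.
move=> mFn mGn FnF GnG FM GM cF cG H.
have cv : gauss_form (Fn n) (Gn n) @[n --> \oo] --> gauss_form F G.
  apply: (@dominated_cvg _ _ _ P setT measurableT _ _ (cst (M `^ a * M `^ b)%:E)).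
  - by move=> n; exact: measurable_gauss_form.
  - move=> z _; apply: cvg_EFin; first exact: nearW.
    by apply: cvgM; apply: cvg_powR_below.
  - by [].
  - exact: finite_measure_integrable_cst.
  - move=> n z _; rewrite gee0_abs ?lee_fin ?mulr_ge0 ?powR_ge0//.
    have /andP[f1 f2] := FnF n z.1; have /andP[g1 g2] := GnG n (Y z).
    have f3 := le_trans f2 (FM z.1); have g3 := le_trans g2 (GM (Y z)).
    have f4 := le_trans f1 f3; have g4 := le_trans g1 g3.
    by rewrite ler_pM ?powR_ge0// ge0_ler_powR ?nnegrE// ltW.
by apply: cvge_le cv; exact: nearW.
Qed.

End extension.

(** * Outer approximation by open sets *)

Section outer_approx.
Context {R : realType}.
Local Notation gam := (normal_prob (0 : R) 1).
Local Notation leb := (@lebesgue_measure R).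

(** Lower semicontinuity without slack. Indicators of open sets have it, it is stable under
    nonnegative combinations, and it makes [Num.min (F z) (F x)] equal to [F x] for [z] near [x]. *)
Definition locally_ge (F : R -> R) := forall x : R, \forall z \near x, F x <= F z.

(** Outer regularity transfers from Lebesgue measure because the density is at most [normal_peak 1];
    the Lebesgue excess is chosen smaller by that factor. *)
Lemma gauss_outer_regular (A : set R) (e : R) : measurable A ->
  (leb A < +oo)%E -> 0 < e ->
  exists U : set R, [/\ open U, A `<=` U & (gam U <= gam A + e%:E)%E].
Proof.
move=> mA Aoo e0.
have p0 : 0 < normal_peak (1 : R) by rewrite normal_peak_gt0 ?oner_eq0.
have e'0 : 0 < e / normal_peak 1 by rewrite divr_gt0.
have [U [oU AU UA]] := lebesgue_regularity_outer mA Aoo e'0.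
exists U; split => //.
have mU : measurable U by exact: open_measurable.
have -> : U = A `|` (U `\` A) by rewrite setDUK.
have mUA : measurable (U `\` A) by exact: measurableD.
apply: (le_trans (measureU2 gam mA mUA)); rewrite leeD2l//.
rewrite /normal_prob.
apply: (@le_trans _ _ (\int[leb]_(x in U `\` A) (normal_peak 1)%:E)%E).
  apply: ge0_le_integral => //.
  - by move=> x _; rewrite lee_fin normal_pdf_ge0.
  - by apply/measurable_EFinP/measurable_funTS; exact: measurable_normal_pdf.
  - by move=> x _; rewrite lee_fin normal_pdf_ub ?oner_eq0.
rewrite integral_cst//.
apply: le_trans (lee_wpmul2l _ (ltW UA)) _; first by rewrite lee_fin ltW.
by rewrite -EFinM lee_fin mulrC divfK ?gt_eqF.
Qed.

Lemma locally_ge_indic (U : set R) : open U -> locally_ge \1_U.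
Proof.
move=> oU x; have [xU|xU] := pselect (U x); last first.
  by near=> z; rewrite indicE memNset.
have nU : nbhs x U by apply: open_nbhs_nbhs.
near=> z; suff Uz : U z by rewrite !indicE !mem_set.
by near: z.
Unshelve. all: by end_near. Qed.

Lemma outer_approx_sum (I : Type) (s : seq I) (c : I -> R) (A : I -> set R) (e : R) :
  (forall i, 0 <= c i) -> (forall i, measurable (A i)) ->
  (forall i, (leb (A i) < +oo)%E) -> 0 < e ->
  exists (H : R -> R) (M : R), [/\ measurable_fun setT H, locally_ge H,
    (forall x, 0 <= H x <= M), (forall x, \sum_(i <- s) c i * \1_(A i) x <= H x) &
    \int[gam]_x H x <= \int[gam]_x (\sum_(i <- s) c i * \1_(A i) x) + e].
Proof.
move=> c0 mA Afin; elim: s e => [|i s IH] e e0.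
  exists (fun=> 0), 0; split => //.
  - by move=> x; near=> z.
  - by move=> x; rewrite lexx.
  - by move=> x; rewrite big_nil.
  - by under [in leRHS]eq_Rintegral do rewrite big_nil; rewrite Rintegral_cst1 add0r ltW.
have e20 : 0 < e / 2 by rewrite divr_gt0.
have [H [M [mH lH HM sH iH]]] := IH _ e20.
(* Half of the error goes to the head and half to the tail; the 1 in [c i + 1] avoids dividing by a
   zero coefficient. *)
have d0 : 0 < e / 2 / (c i + 1) by rewrite divr_gt0// ltr_wpDl.
have [U [oU AU gU]] := gauss_outer_regular _ _ (mA i) (Afin i) d0.
have mU : measurable U by exact: open_measurable.
have mi (B : set R) : measurable B -> gam.-integrable setT (EFin \o (\1_B : R -> R)).
  move=> mB; apply: (@integrable_gauss_bounded _ _ 1); first exact: measurable_indic.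
  by move=> x; rewrite indicE; case: (x \in B); rewrite ?lexx ?ler01.
have intB (B : set R) : measurable B -> \int[gam]_x \1_B x = fine (gam B).
  by move=> mB; rewrite /Rintegral integral_indic// setIT.
have msum : measurable_fun setT (fun x => \sum_(j <- s) c j * \1_(A j) x).
  apply: measurable_sum => j; apply: measurable_funM => //; exact: measurable_indic.
have isum : gam.-integrable setT (EFin \o (fun x => \sum_(j <- s) c j * \1_(A j) x)).
  apply: (@integrable_gauss_bounded _ _ M) => // x.
  have /andP[_ HMx] := HM x; rewrite (le_trans (sH x) HMx) andbT.
  by apply: sumr_ge0 => j _; rewrite mulr_ge0// indicE.
have iHi : gam.-integrable setT (EFin \o H) by exact: (@integrable_gauss_bounded _ _ M).
exists (fun x => c i * \1_U x + H x), (c i + M); split.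
- apply: measurable_funD => //; apply: measurable_funM => //; exact: measurable_indic.
- move=> x; have h1 := locally_ge_indic _ oU x; have h2 := lH x.
  near=> z; apply: lerD; last by near: z.
  by apply: ler_wpM2l => //; near: z.
- move=> x; have /andP[h1 h2] := HM x.
  rewrite addr_ge0 ?mulr_ge0 ?indicE//= lerD// ler_piMr//.
  by case: (_ \in _).
- move=> x; rewrite big_cons lerD// ler_wpM2l// !indicE.
  have [xA|xA] := pselect (A i x); last by rewrite (memNset xA).
  by rewrite !mem_set//; exact: AU.
- have [_ ->] := @integrable_lin _ _ _ gam (c i) _ _ (mi _ mU) iHi.
  under [in leRHS]eq_Rintegral do rewrite big_cons.
  have [_ ->] := @integrable_lin _ _ _ gam (c i) _ _ (mi _ (mA i)) isum.
  rewrite !intB//.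
  have gUr : fine (gam U) <= fine (gam (A i)) + e / 2 / (c i + 1).
    rewrite -lee_fin EFinD (fineK (fin_num_measure gam _ mU)).
    by rewrite (fineK (fin_num_measure gam _ (mA i))).
  have hc : c i * (e / 2 / (c i + 1)) <= e / 2.
    rewrite mulrCA ger_pMr// ler_pdivrMr ?ltr_wpDl// mul1r.
    by rewrite lerDl.
  have := ler_wpM2l (c0 i) gUr; lra.
Unshelve. all: by end_near. Qed.

End outer_approx.

(** * The bilinear inequality in dimension one *)

Section bilinear1.
Context {R : realType}.
Local Notation gam := (normal_prob (0 : R) 1).
Local Notation P := ((gam \x gam)%E : probability _ R).
Local Notation leb := (@lebesgue_measure R).
Variables (rho tau a b : R).
Hypotheses (rho0 : 0 < rho) (rt : rho ^+ 2 + tau ^+ 2 = 1).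
Hypotheses (a0 : 0 < a) (a1 : a < 1) (b0 : 0 < b) (b1 : b < 1)
  (rab : rho ^+ 2 * (a * b) <= (1 - a) * (1 - b)).
Local Notation Y := (corr_snd rho tau).
Local Notation bil := (gauss_form rho tau a b).

(** Smoothing may overshoot [F x], which the minimum cuts off. From below, it is bounded by the
    integral of [Num.min (F (r n * x + s n * y)) (F x)], whose integrand is eventually equal to
    [F x] for each fixed [y]. *)
Lemma ou1_liminf (F : R -> R) (M : R) (r s : nat -> R) (x : R) :
  measurable_fun setT F -> (forall x, 0 <= F x <= M) -> locally_ge F ->
  (forall n, 0 < r n) -> r n @[n --> \oo] --> (1 : R) -> s n @[n --> \oo] --> (0 : R) ->
  Num.min (ou1 (r n) (s n) F x) (F x) @[n --> \oo] --> F x.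
Proof.
move=> mF FM lF r0 r1 s0.
have m0 n y : 0 <= Num.min (F (r n * x + s n * y)) (F x) <= M.
  have /andP[h1 h2] := FM x; have /andP[h3 h4] := FM (r n * x + s n * y).
  by rewrite le_min h1 h3 ge_min h2 orbT.
have mm n : measurable_fun setT (fun y => Num.min (F (r n * x + s n * y)) (F x)).
  apply: measurable_minr => //.
  by apply: (measurableT_comp mF); exact: measurable_affD.
have mi n := integrable_gauss_bounded _ _ (mm n) (m0 n).
pose h n := \int[gam]_y Num.min (F (r n * x + s n * y)) (F x).
have ch : (h n)%:E @[n --> \oo] --> (F x)%:E.
  have -> : (fun n => (h n)%:E) = (fun n => \int[gam]_y (Num.min (F (r n * x + s n * y)) (F x))%:E)%E.
    apply/funext => n; rewrite /h /Rintegral fineK//.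
    exact: (integrable_fin_num measurableT (mi n)).
  have -> : (F x)%:E = (\int[gam]_y (F x)%:E)%E.
    by rewrite integral_cst// [X in (_ * X)%E](_ : _ = 1%E) ?mule1//; exact: probability_setT.
  apply: (@dominated_cvg _ _ _ gam setT measurableT _ _ (cst M%:E)).
  - by move=> n; apply/measurable_EFinP; exact: mm.
  - move=> y _; apply: cvg_EFin; first exact: nearW.
    have cz : r n * x + s n * y @[n --> \oo] --> 1 * x + 0 * y.
      by apply: cvgD; apply: cvgMl.
    rewrite mul1r mul0r addr0 in cz.
    apply: cvg_near_cst.
    have := cz _ (lF x); rewrite /nbhs/=.
    apply: filterS => n /= Fn; apply/min_idPr; exact: Fn.
  - by [].
  - exact: finite_measure_integrable_cst.
  - by move=> n y _; have /andP[? ?] := m0 n y; rewrite gee0_abs lee_fin.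
have ch' : h n @[n --> \oo] --> F x.
  by move/fine_cvg : ch.
apply: (@squeeze_cvgr _ _ _ _ h (fun=> F x)) => //; last exact: cvg_cst.
apply: nearW => n; rewrite ge_min lexx orbT andbT le_min; apply/andP; split.
  apply: le_Rintegral => //; first exact: integrable_ou1 mF FM.
  by move=> y _; rewrite ge_min lexx.
rewrite -[leRHS](@Rintegral_cst1 _ _ _ gam); apply: le_Rintegral => //.
  exact: finite_measure_integrable_cst.
by move=> y _; rewrite ge_min lexx orbT.
Qed.

Lemma gauss_form_locally_ge (F G : R -> R) (M : R) :
  measurable_fun setT F -> measurable_fun setT G ->
  (forall x, 0 <= F x <= M) -> (forall x, 0 <= G x <= M) ->
  locally_ge F -> locally_ge G ->
  (bil F G <= ((\int[gam]_x F x) `^ a * (\int[gam]_x G x) `^ b)%:E)%E.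
Proof.
move=> mF mG FM GM lF lG.
(* Starting at 1/2 keeps [s n < 1], so that [r n > 0] for every [n]. *)
pose s (n : nat) : R := n.+2%:R^-1.
pose r n := Num.sqrt (1 - s n ^+ 2).
have s0 n : 0 < s n by rewrite invr_gt0.
have s1 n : s n < 1 by rewrite invf_lt1// ltr1n.
have ss n : s n ^+ 2 < 1 by rewrite exprn_ilt1// ltW.
have r0 n : 0 < r n by rewrite sqrtr_gt0 subr_gt0.
have rs n : r n ^+ 2 + s n ^+ 2 = 1 by rewrite sqr_sqrtr ?subr_ge0 ?ltW// subrK.
have cs : s n @[n --> \oo] --> (0 : R).
  by move: (@cvg_harmonic R); rewrite -cvg_shiftS.
have cr : r n @[n --> \oo] --> (1 : R).
  have c1 : 1 - s n ^+ 2 @[n --> \oo] --> (1 - 0 ^+ 2 : R).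
    by apply: cvgB; [exact: cvg_cst|rewrite !expr2; exact: cvgM].
  rewrite expr0n/= subr0 in c1.
  rewrite -[X in _ --> X]sqrtr1; apply: (cvg_comp _ (@Num.sqrt R) c1).
  exact: sqrt_continuous.
have mo (H : R -> R) n : measurable_fun setT H -> (forall x, 0 <= H x <= M) ->
    measurable_fun setT (fun x => Num.min (ou1 (r n) (s n) H x) (H x)).
  move=> mH HM; apply: measurable_minr => //; exact: measurable_ou1 mH HM.
have bo (H : R -> R) n x : measurable_fun setT H -> (forall x, 0 <= H x <= M) ->
    0 <= Num.min (ou1 (r n) (s n) H x) (H x).
  move=> mH HM; have /andP[h1 _] := @ou1_bound R (r n) (s n) M H x (r0 n) mH HM.
  by have /andP[h2 _] := HM x; rewrite le_min h1 h2.
apply: (@gauss_form_below_limit R rho tau a b a0 b0 F G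
  (fun n x => Num.min (ou1 (r n) (s n) F x) (F x))
  (fun n x => Num.min (ou1 (r n) (s n) G x) (G x)) M).
- by move=> n; exact: mo.
- by move=> n; exact: mo.
- by move=> n x; rewrite bo//= ge_min lexx orbT.
- by move=> n x; rewrite bo//= ge_min lexx orbT.
- by move=> x; have /andP[] := FM x.
- by move=> x; have /andP[] := GM x.
- by move=> x; exact: ou1_liminf mF FM lF r0 cr cs.
- by move=> x; exact: ou1_liminf mG GM lG r0 cr cs.
(* Dropping the minimum only enlarges the form, and the bound for [ou1] already involves the
   integrals of [F] and [G] themselves. *)
move=> n; apply: le_trans (@gauss_form_ou1 R rho tau a b rho0 rt a0 a1 b0 b1 rab
  (r n) (s n) M F G (r0 n) (s0 n) (rs n) mF mG FM GM).
apply: le_gauss_form.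
- exact: a0.
- exact: b0.
- exact: mo.
- exact: mo.
- exact: measurable_ou1 mF FM.
- exact: measurable_ou1 mG GM.
- by move=> x; rewrite bo//= ge_min lexx.
- by move=> x; rewrite bo//= ge_min lexx.
Qed.

Lemma gauss_form_simple (I J : Type) (s : seq I) (t : seq J) (c : I -> R) (d : J -> R)
    (A : I -> set R) (B : J -> set R) :
  (forall i, 0 <= c i) -> (forall i, measurable (A i)) ->
  (forall i, (leb (A i) < +oo)%E) ->
  (forall j, 0 <= d j) -> (forall j, measurable (B j)) ->
  (forall j, (leb (B j) < +oo)%E) ->
  forall F G : R -> R,
  F = (fun x => \sum_(i <- s) c i * \1_(A i) x) ->
  G = (fun x => \sum_(j <- t) d j * \1_(B j) x) ->
  (bil F G <= ((\int[gam]_x F x) `^ a * (\int[gam]_x G x) `^ b)%:E)%E.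
Proof.
move=> c0 mA Afin d0 mB Bfin F G FE GE.
have pos K (u : seq K) (e : K -> R) (D : K -> set R) x : (forall i, 0 <= e i) ->
    0 <= \sum_(i <- u) e i * \1_(D i) x.
  by move=> e0; apply: sumr_ge0 => k _; rewrite mulr_ge0// indicE.
have mS K (u : seq K) (e : K -> R) (D : K -> set R) : (forall i, measurable (D i)) ->
   measurable_fun setT (fun x => \sum_(i <- u) e i * \1_(D i) x).
  by move=> mD; apply: measurable_sum => j; apply: measurable_funM => //; exact: measurable_indic.
have IF0 : 0 <= \int[gam]_x F x by apply: Rintegral_ge0 => x _; rewrite FE; exact: pos.
have IG0 : 0 <= \int[gam]_x G x by apply: Rintegral_ge0 => x _; rewrite GE; exact: pos.
apply: powR_prod_lim => // e e0.
have [H [M [mH lH HM sH iH]]] := outer_approx_sum _ s c A e c0 mA Afin e0.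
have [K [N [mK lK KN sK iK]]] := outer_approx_sum _ t d B e d0 mB Bfin e0.
have HM' x : 0 <= H x <= Num.max M N.
  by have /andP[-> h] := HM x; rewrite le_max h.
have KN' x : 0 <= K x <= Num.max M N.
  by have /andP[-> h] := KN x; rewrite le_max h orbT.
apply: (@le_trans _ _ (bil H K)).
  apply: le_gauss_form => //.
  - by rewrite FE; exact: mS.
  - by rewrite GE; exact: mS.
  - by move=> x; rewrite FE pos//= sH.
  - by move=> x; rewrite GE pos//= sK.
apply: le_trans (gauss_form_locally_ge _ _ _ mH mK HM' KN' lH lK) _.
have IH0 : 0 <= \int[gam]_x H x by apply: Rintegral_ge0 => x _; have /andP[] := HM x.
have IK0 : 0 <= \int[gam]_x K x by apply: Rintegral_ge0 => x _; have /andP[] := KN x.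
rewrite -FE in iH; rewrite -GE in iK.
rewrite lee_fin ler_pM ?powR_ge0//.
  by rewrite ge0_ler_powR ?nnegrE ?(ltW a0)// addr_ge0// ltW.
by rewrite ge0_ler_powR ?nnegrE ?(ltW b0)// addr_ge0// ltW.
Qed.

Import HBNNSimple.

Lemma simple_approx (F : R -> R) (M : R) : measurable_fun setT F ->
  (forall x, 0 <= F x <= M) ->
  exists Fn : nat -> R -> R,
  [/\ (forall n, measurable_fun setT (Fn n)),
      (forall n x, 0 <= Fn n x <= F x),
      (forall x, Fn n x @[n --> \oo] --> F x) &
      (forall n, exists (s : seq R) (c : R -> R) (A : R -> set R),
        [/\ (forall i, 0 <= c i), (forall i, measurable (A i)),
            (forall i, (leb (A i) < +oo)%E) &
            Fn n = (fun x => \sum_(i <- s) c i * \1_(A i) x)])].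
Proof.
move=> mF FM.
have mF' : measurable_fun setT (EFin \o F) by exact/measurable_EFinP.
pose h := nnsfun_approx measurableT mF'.
(* Cutting down to a bounded interval gives the level sets finite Lebesgue measure, as the outer
   approximation requires. *)
pose D (n : nat) : set R := `[- n%:R, n%:R]%classic.
have mD n : measurable (D n) by exact: measurable_itv.
have F0 x : (0 <= (EFin \o F) x)%E by rewrite lee_fin; have /andP[] := FM x.
have hc x : (h n x)%:E @[n --> \oo] --> (F x)%:E.
  by apply: cvg_nnsfun_approx.
have hF n x : h n x <= F x.
  rewrite -lee_fin; apply: cvge_ge (hc x); exists n => // m /= nm.
  by rewrite lee_fin; exact/lefP/nd_nnsfun_approx.
exists (fun n x => h n x * \1_(D n) x); split.
- by move=> n; apply: measurable_funM => //; exact: measurable_indic.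
- move=> n x; rewrite mulr_ge0 ?indicE//=.
  apply: le_trans (hF n x); rewrite ler_piMr//.
  by case: (_ \in _).
- move=> x; have hc' : h n x @[n --> \oo] --> F x by move/fine_cvg : (hc x).
  rewrite -[F x]mulr1; apply: cvgM => //.
  apply: cvg_near_cst; near=> n.
  rewrite indicE mem_set//= /D/= in_itv/= -ler_norml.
  near: n; exact: nbhs_infty_ger.
(* The maximum makes the coefficient nonnegative at every real index; on the range of [h n] it is
   the value itself. *)
- move=> n; exists (finmap.enum_fset (fset_set (range (h n)))), (fun y => Num.max 0 y),
    (fun y => h n @^-1` [set y] `&` D n); split.
  + by move=> y; rewrite le_max lexx.
  + by move=> y; apply: measurableI.
  + move=> y; apply: (@le_lt_trans _ _ (leb (D n))).
      have mA : measurable (h n @^-1` [set y] `&` D n) by apply: measurableI.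
      apply: le_measure; rewrite ?inE; [exact: mA|exact: mD|exact: subIsetr].
    by rewrite lebesgue_measure_itv/=; case: ifP => _; rewrite ?ltry// -EFinD ltry.
  + apply/funext => x; rewrite {1}fimfunE fsbig_finite//= mulr_suml.
    rewrite !big_seq; apply: eq_bigr => y; rewrite in_fset_set// inE => -[t _ <-].
    by rewrite indicI/= mulrA max_r.
Unshelve. all: by end_near. Qed.

(** Simple functions approximate from below: the left side converges by domination, and the right
    side of each approximation is at most that of the limit. *)
Theorem gauss_form_bounded (F G : R -> R) (M : R) :
  measurable_fun setT F -> measurable_fun setT G ->
  (forall x, 0 <= F x <= M) -> (forall x, 0 <= G x <= M) ->
  (bil F G <= ((\int[gam]_x F x) `^ a * (\int[gam]_x G x) `^ b)%:E)%E.
Proof.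
move=> mF mG FM GM.
have [Fn [mFn FnF cFn sFn]] := simple_approx _ _ mF FM.
have [Gn [mGn GnG cGn sGn]] := simple_approx _ _ mG GM.
apply: (@gauss_form_below_limit R rho tau a b a0 b0 F G Fn Gn M) => //.
- by move=> x; have /andP[] := FM x.
- by move=> x; have /andP[] := GM x.
move=> n.
have i0 (H : R -> R) : (forall x, 0 <= H x) -> 0 <= \int[gam]_x H x.
  by move=> H0; apply: Rintegral_ge0.
have Fn0 x : 0 <= Fn n x by have /andP[] := FnF n x.
have Gn0 x : 0 <= Gn n x by have /andP[] := GnG n x.
have FnM x : 0 <= Fn n x <= M.
  have /andP[-> h]/= := FnF n x; apply: le_trans h _; by have /andP[] := FM x.
have GnM x : 0 <= Gn n x <= M.
  have /andP[-> h]/= := GnG n x; apply: le_trans h _; by have /andP[] := GM x.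
apply: (@le_trans _ _ ((\int[gam]_x Fn n x) `^ a * (\int[gam]_x Gn n x) `^ b)%:E).
  have [s [c [A [c0 mA Af FE]]]] := sFn n.
  have [t [d [B [d0 mB Bf GE]]]] := sGn n.
  exact: (gauss_form_simple _ _ s t c d A B c0 mA Af d0 mB Bf _ _ FE GE).
have le_int (H K : R -> R) : measurable_fun setT H -> measurable_fun setT K ->
    (forall x, 0 <= H x <= M) -> (forall x, 0 <= K x <= M) ->
    (forall x, H x <= K x) -> \int[gam]_x H x <= \int[gam]_x K x.
  move=> mH mK HM KM HK; apply: le_Rintegral => //.
  - exact: integrable_gauss_bounded mH HM.
  - exact: integrable_gauss_bounded mK KM.
have F0 x : 0 <= F x by have /andP[] := FM x.
have G0 x : 0 <= G x by have /andP[] := GM x.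
rewrite lee_fin ler_pM ?powR_ge0// ge0_ler_powR ?nnegrE ?i0 ?(ltW a0) ?(ltW b0)//.
  by apply: le_int => // x; have /andP[] := FnF n x.
by apply: le_int => // x; have /andP[] := GnG n x.
Qed.

End bilinear1.

(** * Tensorization *)

Section tensor.
Context {R : realType}.
Local Notation gam := (normal_prob (0 : R) 1).

Lemma EFin_Rintegral d (T : measurableType d) (P : probability T R) (F : T -> R) M :
  measurable_fun setT F -> (forall x, 0 <= F x <= M) ->
  (\int[P]_x F x)%:E = (\int[P]_x (F x)%:E)%E.
Proof.
move=> mF FM; rewrite /Rintegral fineK//; apply: integrable_fin_num => //.
apply: (@integrable_bounded _ _ _ P _ M) => // x.
by have /andP[f0 f1] := FM x; rewrite ger0_norm.
Qed.

Lemma Rintegral_bounds d (T : measurableType d) (P : probability T R) (F : T -> R) M :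
  measurable_fun setT F -> (forall x, 0 <= F x <= M) -> 0 <= \int[P]_x F x <= M.
Proof.
move=> mF FM; have F0 x : 0 <= F x by have /andP[] := FM x.
rewrite Rintegral_ge0//= -[leRHS](@Rintegral_cst1 _ _ _ P); apply: le_Rintegral => //.
- apply: (@integrable_bounded _ _ _ P _ M) => // x.
  by rewrite ger0_norm//; have /andP[] := FM x.
- exact: finite_measure_integrable_cst.
- by move=> x _; have /andP[] := FM x.
Qed.

Lemma measurable_Rintegral d d' (T : measurableType d) (U : measurableType d')
  (P : probability U R) (F : T * U -> R) M :
  measurable_fun setT F -> (forall x, 0 <= F x <= M) ->
  measurable_fun setT (fun x => \int[P]_y F (x, y)).
Proof.
move=> mF FM; apply/measurable_EFinP.
rewrite (_ : _ \o _ = (fun x => \int[P]_y (F (x, y))%:E)%E); last first.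
  apply/funext => x /=; apply: (@EFin_Rintegral _ _ _ _ M) => //.
  by apply: measurableT_comp.
apply: (@measurable_fun_fubini_tonelli_F _ _ _ _ _ P (EFin \o F)).
  exact/measurable_EFinP.
by move=> z; rewrite lee_fin; have /andP[] := FM z.
Qed.

Lemma measurable_mehler_pt d (t : R) :
  measurable_fun setT (fun z : Rn R d * Rn R d => mehler_pt t z.1 z.2).
Proof.
apply/measurable_fun_tnthP => i.
rewrite (_ : _ \o _ = (fun z : Rn R d * Rn R d => expR (- t) * tnth z.1 i
   + Num.sqrt (1 - expR (- (2 * t))) * tnth z.2 i)); last first.
  by apply/funext => z; rewrite /= tnth_mktuple.
apply: measurable_funD; apply: measurable_funM; try exact: measurable_cst.
  exact: (measurableT_comp (measurable_tnth i) measurable_fst).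
exact: (measurableT_comp (measurable_tnth i) measurable_snd).
Qed.

Lemma mehler_pt_cons d (t u v : R) (x y : Rn R d) :
  mehler_pt t (@consT R d (u, x)) (@consT R d (v, y)) =
  @consT R d (expR (- t) * u + Num.sqrt (1 - expR (- (2 * t))) * v, mehler_pt t x y).
Proof.
apply/eq_from_tnth => i; rewrite tnth_mktuple.
case: (unliftP ord0 i) => [j ->|->].
  by rewrite /consT !tnthS tnth_mktuple.
by rewrite /consT !tnth0.
Qed.

Lemma ge0_integral_std_gaussS d (f : Rn R d.+1 -> \bar R) :
  measurable_fun setT f -> (forall x, 0 <= f x)%E ->
  (\int[std_gauss R d.+1]_x f x =
   \int[gam]_u \int[std_gauss R d]_x f (@consT R d (u, x)))%E.
Proof.
move=> mf f0; rewrite ge0_integral_distribution//.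
rewrite (@fubini_tonelli1 _ _ _ _ _ gam (std_gauss R d) (f \o @consT R d)); last 2 first.
- by apply: (measurableT_comp mf); exact: measurable_consT.
- by move=> z; exact: f0.
by [].
Qed.

Section induction.
Variables (t a b : R).
Let rho := expR (- t).
Let tau := Num.sqrt (1 - expR (- (2 * t))).
Hypotheses (t0 : 0 <= t).
Hypotheses (a0 : 0 < a) (a1 : a < 1) (b0 : 0 < b) (b1 : b < 1)
  (rab : rho ^+ 2 * (a * b) <= (1 - a) * (1 - b)).

Let rho_gt0 : 0 < rho. Proof. exact: expR_gt0. Qed.

Let rho_tau : rho ^+ 2 + tau ^+ 2 = 1.
Proof.
rewrite sqr_sqrtr; last by rewrite subr_ge0 -expR0 ler_expR oppr_le0 mulr_ge0.
by rewrite /rho -expRM_natl mulrN addrC subrK.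
Qed.

(** Induction on [d]. With the other coordinates frozen, the one-dimensional inequality treats the
    first coordinates and replaces [F] and [G] by their partial integrals. These come out with the
    same powers [a] and [b], so the induction hypothesis applies to them. In dimension 0 there is a
    single point and both sides agree. *)
Theorem mehler_bilinear d (F G : Rn R d -> R) (M : R) :
  measurable_fun setT F -> measurable_fun setT G ->
  (forall x, 0 <= F x <= M) -> (forall x, 0 <= G x <= M) ->
  (\int[std_gauss R d]_x \int[std_gauss R d]_y
     (F x `^ a * G (mehler_pt t x y) `^ b)%:E <=
   ((\int[std_gauss R d]_x F x) `^ a * (\int[std_gauss R d]_x G x) `^ b)%:E)%E.
Proof.
elim: d F G => [|d IH] F G mF mG FM GM.
  have i0 (f : Rn R 0 -> \bar R) : (\int[std_gauss R 0]_x f x = f [tuple])%E.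
    rewrite (_ : f = cst (f [tuple])); last by apply/funext => x; rewrite [x]tuple0.
    rewrite integral_cst// [X in (_ * X)%E](_ : _ = 1%E) ?mule1//.
    exact: probability_setT.
  by rewrite !i0 /Rintegral !i0/= [mehler_pt _ _ _]tuple0 lexx.
pose mu := std_gauss R d.
have mC := @measurable_consT R d.
pose K (u : R) (x : Rn R d) (v : R) (y : Rn R d) : \bar R :=
  (F (@consT R d (u, x)) `^ a * G (@consT R d (rho * u + tau * v, mehler_pt t x y)) `^ b)%:E.
have K0 u x v y : (0 <= K u x v y)%E by rewrite lee_fin mulr_ge0 ?powR_ge0.
have mK e (T : measurableType e) (u v : T -> R) (x y : T -> Rn R d) :
   measurable_fun setT u -> measurable_fun setT v ->
   measurable_fun setT x -> measurable_fun setT y ->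
   measurable_fun setT (fun z => K (u z) (x z) (v z) (y z)).
  move=> mu_ mv mx my; apply: measurable_powR_prod.
    exact: (measurableT_comp mF (measurableT_comp mC (measurable_fun_pair mu_ mx))).
  apply: (measurableT_comp mG (measurableT_comp mC _)).
  apply: measurable_fun_pair.
    apply: measurable_funD; apply: measurable_funM => //; exact: measurable_cst.
  exact: (measurableT_comp (@measurable_mehler_pt d t) (measurable_fun_pair mx my)).
have LE : (\int[std_gauss R d.+1]_x \int[std_gauss R d.+1]_y
     (F x `^ a * G (mehler_pt t x y) `^ b)%:E =
   \int[gam]_u \int[mu]_x \int[gam]_v \int[mu]_y K u x v y)%E.
  have mH : measurable_fun setT (fun z : Rn R d.+1 * Rn R d.+1 =>
      (F z.1 `^ a * G (mehler_pt t z.1 z.2) `^ b)%:E).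
    apply: measurable_powR_prod; first exact: (measurableT_comp mF measurable_fst).
    exact: (measurableT_comp mG (@measurable_mehler_pt d.+1 t)).
  have H0 (z : Rn R d.+1 * Rn R d.+1) : (0 <= (F z.1 `^ a * G (mehler_pt t z.1 z.2) `^ b)%:E)%E.
    by rewrite lee_fin mulr_ge0 ?powR_ge0.
  rewrite ge0_integral_std_gaussS; last 2 first.
  - exact: (@measurable_fun_fubini_tonelli_F _ _ _ _ _ (std_gauss R d.+1) _ mH H0).
  - by move=> x; apply: integral_ge0 => y _; exact: (H0 (x, y)).
  apply: eq_integral => u _; apply: eq_integral => x _.
  rewrite ge0_integral_std_gaussS; last 2 first.
  - exact: (measurableT_comp mH (measurable_pair1 _)).
  - by move=> y; exact: (H0 (_, y)).
  by apply: eq_integral => v _; apply: eq_integral => y _; rewrite mehler_pt_cons.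
rewrite {}LE.
have mI e (T : measurableType e) e' (U : measurableType e') (P : probability U R) (H : T * U -> \bar R) :
   measurable_fun setT H -> (forall z, 0 <= H z)%E ->
   measurable_fun setT (fun x => \int[P]_y H (x, y))%E.
  by move=> mH H0; exact: (@measurable_fun_fubini_tonelli_F _ _ _ _ _ P H mH H0).
have ton e (T : measurableType e) e' (U : measurableType e') (Q : probability T R)
    (P : probability U R) (H : T * U -> \bar R) :
   measurable_fun setT H -> (forall z, 0 <= H z)%E ->
   (\int[Q]_x \int[P]_y H (x, y) = \int[P]_y \int[Q]_x H (x, y))%E.
  by move=> mH H0; exact: (@fubini_tonelli _ _ _ _ _ Q P H mH H0).
(* Tonelli brings the first coordinates [u] and [v] innermost. *)
have -> : (\int[gam]_u \int[mu]_x \int[gam]_v \int[mu]_y K u x v y =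
   \int[mu]_x \int[mu]_y \int[gam]_u \int[gam]_v K u x v y)%E.
  transitivity (\int[gam]_u \int[mu]_x \int[mu]_y \int[gam]_v K u x v y)%E.
    apply: eq_integral => u _; apply: eq_integral => x _.
    apply: (ton _ _ _ _ gam mu (fun z => K u x z.1 z.2)) => //.
    by apply: mK; [exact: measurable_cst|exact: measurable_fst|exact: measurable_cst|exact: measurable_snd].
  transitivity (\int[mu]_x \int[gam]_u \int[mu]_y \int[gam]_v K u x v y)%E.
    apply: (ton _ _ _ _ gam mu (fun z => \int[mu]_y \int[gam]_v K z.1 z.2 v y)%E).
      apply: (mI _ _ _ _ mu (fun z => \int[gam]_v K z.1.1 z.1.2 v z.2)%E).
        apply: (mI _ _ _ _ gam (fun z => K z.1.1.1 z.1.1.2 z.2 z.1.2)) => //.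
        apply: mK.
        - exact: (measurableT_comp measurable_fst (measurableT_comp measurable_fst measurable_fst)).
        - exact: measurable_snd.
        - exact: (measurableT_comp measurable_snd (measurableT_comp measurable_fst measurable_fst)).
        - exact: (measurableT_comp measurable_snd measurable_fst).
      by move=> z; exact: integral_ge0.
    by move=> z; apply: integral_ge0 => y _; exact: integral_ge0.
  apply: eq_integral => x _.
  apply: (ton _ _ _ _ gam mu (fun z => \int[gam]_v K z.1 x v z.2)%E).
    apply: (mI _ _ _ _ gam (fun z => K z.1.1 x z.2 z.1.2)) => //.
    apply: mK.
    - exact: (measurableT_comp measurable_fst measurable_fst).
    - exact: measurable_snd.
    - exact: measurable_cst.
    - exact: (measurableT_comp measurable_snd measurable_fst).
  by move=> z; exact: integral_ge0.
pose F' x := \int[gam]_u F (@consT R d (u, x)).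
pose G' x := \int[gam]_u G (@consT R d (u, x)).
have mFc (H : Rn R d.+1 -> R) x : measurable_fun setT H ->
    measurable_fun setT (fun u => H (@consT R d (u, x))).
  by move=> mH; exact: (measurableT_comp mH (measurableT_comp mC (measurable_pair2 x))).
have mF' (H : Rn R d.+1 -> R) : measurable_fun setT H -> (forall x, 0 <= H x <= M) ->
    measurable_fun setT (fun x => \int[gam]_u H (@consT R d (u, x))).
  move=> mH HM.
  apply: (@measurable_Rintegral _ _ _ _ gam (fun z => H (@consT R d (z.2, z.1))) M) => //.
  apply: (measurableT_comp mH (measurableT_comp mC _)).
  by apply: measurable_fun_pair; [exact: measurable_snd|exact: measurable_fst].
have bF' (H : Rn R d.+1 -> R) x : measurable_fun setT H -> (forall x, 0 <= H x <= M) ->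
    0 <= \int[gam]_u H (@consT R d (u, x)) <= M.
  by move=> mH HM; apply: Rintegral_bounds => //; exact: mFc.
have iF' (H : Rn R d.+1 -> R) : measurable_fun setT H -> (forall x, 0 <= H x <= M) ->
    \int[mu]_x \int[gam]_u H (@consT R d (u, x)) = \int[std_gauss R d.+1]_x H x.
  move=> mH HM; apply: EFin_inj.
  rewrite (@EFin_Rintegral _ _ _ _ M)//; last 2 first.
  - exact: mF'.
  - by move=> x; exact: bF'.
  rewrite (@EFin_Rintegral _ _ _ _ M)// ge0_integral_std_gaussS; last 2 first.
  - exact/measurable_EFinP.
  - by move=> x; rewrite lee_fin; have /andP[] := HM x.
  rewrite (ton _ _ _ _ gam mu (fun z => (H (@consT R d z))%:E)); last 2 first.
  - by apply/measurable_EFinP; exact: (measurableT_comp mH mC).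
  - by move=> x; rewrite lee_fin; have /andP[] := HM (@consT R d x).
  apply: eq_integral => x _; apply: (@EFin_Rintegral _ _ _ _ M) => //.
  exact: mFc.
have := IH F' G' (mF' _ mF FM) (mF' _ mG GM) (fun x => bF' F x mF FM) (fun x => bF' G x mG GM).
rewrite /F' /G' (iF' _ mF FM) (iF' _ mG GM); apply: le_trans.
apply: ge0_le_integral; first exact: measurableT.
- by move=> x _; do 3 apply: integral_ge0 => ? _.
- apply: (mI _ _ _ _ mu (fun z => \int[gam]_u \int[gam]_v K u z.1 v z.2)%E).
    apply: (mI _ _ _ _ gam (fun z => \int[gam]_v K z.2 z.1.1 v z.1.2)%E).
      apply: (mI _ _ _ _ gam (fun z => K z.1.2 z.1.1.1 z.2 z.1.1.2)) => //.
      apply: mK.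
      - exact: (measurableT_comp measurable_snd measurable_fst).
      - exact: measurable_snd.
      - exact: (measurableT_comp measurable_fst (measurableT_comp measurable_fst measurable_fst)).
      - exact: (measurableT_comp measurable_snd (measurableT_comp measurable_fst measurable_fst)).
    by move=> z; exact: integral_ge0.
  by move=> z; do 2 apply: integral_ge0 => ? _.
- apply: (mI _ _ _ _ mu (fun z => (F' z.1 `^ a * G' (mehler_pt t z.1 z.2) `^ b)%:E)).
    apply: measurable_powR_prod; first exact: (measurableT_comp (mF' _ mF FM) measurable_fst).
    exact: (measurableT_comp (mF' _ mG GM) (@measurable_mehler_pt d t)).
  by move=> z; rewrite lee_fin mulr_ge0 ?powR_ge0.
move=> x _; apply: ge0_le_integral; first exact: measurableT.
- by move=> y _; do 2 apply: integral_ge0 => ? _.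
- apply: (mI _ _ _ _ gam (fun z => \int[gam]_v K z.2 x v z.1)%E).
    apply: (mI _ _ _ _ gam (fun z => K z.1.2 x z.2 z.1.1)) => //.
    apply: mK.
    - exact: (measurableT_comp measurable_snd measurable_fst).
    - exact: measurable_snd.
    - exact: measurable_cst.
    - exact: (measurableT_comp measurable_fst measurable_fst).
  by move=> z; exact: integral_ge0.
- apply: measurable_powR_prod; first exact: measurable_cst.
  exact: (measurableT_comp (mF' _ mG GM) (measurableT_comp (@measurable_mehler_pt d t) (measurable_pair1 x))).
move=> y _.
have := @gauss_form_bounded R rho tau a b rho_gt0 rho_tau a0 a1 b0 b1 rab
  (fun u => F (@consT R d (u, x))) (fun u => G (@consT R d (u, mehler_pt t x y))) M
  (mFc _ _ mF) (mFc _ _ mG) (fun u => FM _) (fun u => GM _).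
apply: le_trans; rewrite /gauss_form.
rewrite (@fubini_tonelli1 _ _ _ _ _ gam gam); last 2 first.
- exact: (@measurable_gauss_form R rho tau a b _ _ (mFc _ x mF) (mFc _ (mehler_pt t x y) mG)).
- by move=> z; rewrite lee_fin mulr_ge0 ?powR_ge0.
by [].
Qed.

End induction.

End tensor.

(** * Hypercontractivity *)

Section hypercontractivity.
Context {R : realType} (d : nat).
Local Notation mu := (std_gauss R d).

Lemma measurable_mehler_section (t : R) (x : Rn R d) :
  measurable_fun setT (mehler_pt t x).
Proof. exact: (measurableT_comp (@measurable_mehler_pt R d t) (measurable_pair1 x)). Qed.

(** Valid also at points where the integral has the form oo - oo, since the right side is then
    [+oo]. *)
Lemma le_abse_OU (t : R) (f : Rn R d -> R) x : measurable_fun setT f ->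
  (`|OU t f x| <= \int[mu]_y `|f (mehler_pt t x y)|%:E)%E.
Proof.
move=> mf; apply: le_trans (le_abse_integral _ _ _) _ => //.
by apply/measurable_EFinP; apply: (measurableT_comp mf); exact: measurable_mehler_section.
Qed.

Lemma measurable_OU (t : R) (f : Rn R d -> R) : measurable_fun setT f ->
  measurable_fun setT (OU t f).
Proof.
move=> mf; rewrite /OU; under eq_fun do rewrite integralE.
have mz : measurable_fun setT (fun z : Rn R d * Rn R d => (f (mehler_pt t z.1 z.2))%:E).
  by apply/measurable_EFinP; exact: (measurableT_comp mf (@measurable_mehler_pt R d t)).
apply: emeasurable_funB.
  have := @measurable_fun_fubini_tonelli_F _ _ _ _ _ mu _ (measurable_funepos mz) (fun z => funepos_ge0 _ z).
  by congr measurable_fun; apply/funext => x; apply: eq_integral => y _; rewrite !unlock.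
have := @measurable_fun_fubini_tonelli_F _ _ _ _ _ mu _ (measurable_funeneg mz) (fun z => funeneg_ge0 _ z).
by congr measurable_fun; apply/funext => x; apply: eq_integral => y _; rewrite !unlock.
Qed.

(** The last step of the duality: divide by the power of [A], which is legitimate because [A] is a
    real number. It is applied with the inverse of the Lebesgue exponent in place of [p]. *)
Lemma powR_cancel_le (A B q p : R) : 0 <= A -> 0 <= B -> 0 < q ->
  A <= A `^ (1 - q^-1) * B `^ p -> A <= B `^ (q * p).
Proof.
move=> A0 B0 q0; have [->|Ane0] := eqVneq A 0.
  by rewrite powR_ge0.
have A_gt0 : 0 < A by rewrite lt_neqAle eq_sym Ane0.
have -> : A `^ (1 - q^-1) = A / A `^ q^-1.
  by rewrite powRB ?powRr1//; apply/implyP.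
move=> h.
have h2 : A * A `^ q^-1 <= A * B `^ p.
  by rewrite -ler_pdivlMr ?powR_gt0// mulrAC.
rewrite ler_pM2l// in h2.
have -> : A = (A `^ q^-1) `^ q by rewrite -powRrM mulVf ?gt_eqF// powRr1.
by rewrite mulrC powRrM ge0_ler_powR ?nnegrE ?powR_ge0// ltW.
Qed.

(** Boundedness makes all the integrals real numbers, as [powR_cancel_le] requires. *)
Lemma bounded_hypercontractive (p q t m : R) (f : Rn R d -> R) :
  1 < p -> 0 <= t -> q = expR (2 * t) * (p - 1) + 1 ->
  measurable_fun setT f -> (forall x, 0 <= f x <= m) ->
  (\int[mu]_x ((\int[mu]_y f (mehler_pt t x y)) `^ q)%:E <=
   ((\int[mu]_x (f x `^ p)) `^ (q / p))%:E)%E.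
Proof.
move=> p1 t0 qE mf fm.
have p0 : 0 < p by exact: lt_trans p1.
have q1 : 1 < q by rewrite qE ltrDr mulr_gt0 ?expR_gt0 ?subr_gt0.
have q0 : 0 < q by exact: lt_trans q1.
pose u x := \int[mu]_y f (mehler_pt t x y).
have mS x : measurable_fun setT (fun y => f (mehler_pt t x y)).
  by apply: (measurableT_comp mf); exact: measurable_mehler_section.
have um x : 0 <= u x <= m by apply: Rintegral_bounds.
have u0 x : 0 <= u x by have /andP[] := um x.
have f0 x : 0 <= f x by have /andP[] := fm x.
have m0 : 0 <= m by have /andP[h] := fm [tuple of nseq d 0]; exact: le_trans.
have mu_u : measurable_fun setT u.
  apply: (@measurable_Rintegral _ _ _ _ _ mu (fun z => f (mehler_pt t z.1 z.2)) m) => //.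
  exact: (measurableT_comp mf (@measurable_mehler_pt R d t)).
have mpow (g : Rn R d -> R) (r : R) : measurable_fun setT g ->
    measurable_fun setT (fun x => g x `^ r).
  by move=> mg; exact: (measurableT_comp (measurable_powR _) mg).
pose M := Num.max (m `^ q) (m `^ p).
have bpow (g : Rn R d -> R) (r : R) x : 0 < r -> (forall x, 0 <= g x <= m) ->
    0 <= g x `^ r <= m `^ r.
  move=> r0 gm; have /andP[g0 g1] := gm x.
  by rewrite powR_ge0/= ge0_ler_powR ?nnegrE// ltW.
have buq x : 0 <= u x `^ q <= M.
  by have /andP[-> h] := bpow u q x q0 um; rewrite le_max h.
have bfp x : 0 <= f x `^ p <= M.
  by have /andP[-> h] := bpow f p x p0 fm; rewrite le_max h orbT.
have a0 : 0 < 1 - q^-1 by rewrite subr_gt0 invf_lt1.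
have a1 : 1 - q^-1 < 1 by rewrite gtrBl invr_gt0.
have b0 : 0 < p^-1 by rewrite invr_gt0.
have b1 : p^-1 < 1 by rewrite invf_lt1.
(* An equality, by the choice of [q]: [q - 1 = expR (2 * t) * (p - 1)]. *)
have rab : expR (- t) ^+ 2 * ((1 - q^-1) * p^-1) <= (1 - (1 - q^-1)) * (1 - p^-1).
  rewrite -expRM_natl mulrN expRN.
  have e0 : 0 < expR (2 * t) by exact: expR_gt0.
  have -> : 1 - q^-1 = (q - 1) / q by field; rewrite gt_eqF.
  rewrite {1}qE addrK le_eqVlt; apply/orP; left; apply/eqP.
  by field; rewrite !gt_eqF.
have := @mehler_bilinear R t (1 - q^-1) p^-1 t0 a0 a1 b0 b1 rab d _ _ M
  (mpow _ q mu_u) (mpow _ p mf) buq bfp.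
set A := \int[mu]_x (u x `^ q); set B := \int[mu]_x (f x `^ p).
have AE : (\int[mu]_x (u x `^ q)%:E)%E = A%:E.
  by rewrite (@EFin_Rintegral R _ _ mu _ M)//; exact: mpow.
(* The first factor is [u x ^ (q - 1)] and does not depend on [y]; the second integrates to
   [u x]. *)
have -> : (\int[mu]_x \int[mu]_y ((u x `^ q) `^ (1 - q^-1) *
    (f (mehler_pt t x y) `^ p) `^ p^-1)%:E = A%:E)%E.
  rewrite -AE; apply: eq_integral => x _.
  transitivity ((u x `^ (q - 1))%:E * \int[mu]_y (f (mehler_pt t x y))%:E)%E.
    rewrite -ge0_integralZl; last 4 first.
    - exact: measurableT.
    - exact/measurable_EFinP.
    - by move=> y _; rewrite lee_fin.
    - by rewrite lee_fin powR_ge0.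
    apply: eq_integral => y _; rewrite -EFinM -!powRrM mulfV ?gt_eqF//.
    by rewrite powRr1// mulrBr mulr1 mulfV ?gt_eqF.
  rewrite -(@EFin_Rintegral R _ _ mu _ m)// -EFinM mulrC mulr_powRB1//; exact: u0.
rewrite AE !lee_fin; apply: powR_cancel_le => //.
  by apply: Rintegral_ge0 => x _; exact: powR_ge0.
by apply: Rintegral_ge0 => x _; exact: powR_ge0.
Qed.

(** Truncate the absolute value of [f] at level [m] and let [m] grow, by monotone convergence first
    in the Mehler integral and then in the norm. The limit [U] may take the value [+oo], and it
    dominates the absolute value of [OU t f]. *)
Theorem hypercontractivity (p t : R) (f : Rn R d -> R) :
  1 < p -> f \in Lfun mu p%:E -> 0 <= t ->
  ('N[mu]_((expR (2 * t) * (p - 1) + 1)%:E)[OU t f] <= 'N[mu]_(p%:E)[EFin \o f])%E.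
Proof.
move=> p1 fL t0.
set q := expR (2 * t) * (p - 1) + 1.
have p0 : 0 < p by exact: lt_trans p1.
have q1 : 1 < q by rewrite /q ltrDr mulr_gt0 ?expR_gt0 ?subr_gt0.
have q0 : 0 < q by exact: lt_trans q1.
have mf : measurable_fun setT f by move: fL; rewrite inE => /andP[/[!inE]].
have ifp := Lfun_integrable (ltW p1) fL.
pose fm (m : nat) x := Num.min `|f x| m%:R.
have mfm m : measurable_fun setT (fm m).
  apply: measurable_minr; [exact: measurableT_comp|exact: measurable_cst].
have fmb m x : 0 <= fm m x <= m%:R by rewrite le_min normr_ge0 ler0n ge_min lexx orbT.
have fm0 m x : 0 <= fm m x by have /andP[] := fmb m x.
have fmf m x : fm m x <= `|f x| by rewrite ge_min lexx.
have fmS m n x : (m <= n)%N -> fm m x <= fm n x.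
  move=> mn; rewrite le_min fmf/= ge_min.
  by rewrite (_ : m%:R <= n%:R) ?orbT// ler_nat.
have mS (g : Rn R d -> R) x : measurable_fun setT g ->
    measurable_fun setT (fun y => g (mehler_pt t x y)).
  by move=> mg; apply: (measurableT_comp mg); exact: measurable_mehler_section.
pose um m x := \int[mu]_y fm m (mehler_pt t x y).
pose U x := (\int[mu]_y `|f (mehler_pt t x y)|%:E)%E.
have umE m x : (um m x)%:E = (\int[mu]_y (fm m (mehler_pt t x y))%:E)%E.
  apply: (@EFin_Rintegral R _ _ mu _ m%:R) => //; exact: mS.
have um0 m x : 0 <= um m x by apply: Rintegral_ge0.
have mum m : measurable_fun setT (um m).
  apply: (@measurable_Rintegral _ _ _ _ _ mu (fun z => fm m (mehler_pt t z.1 z.2)) m%:R) => //.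
  exact: (measurableT_comp (mfm m) (@measurable_mehler_pt R d t)).
have umS x : {homo um ^~ x : m n / (m <= n)%N >-> m <= n}.
  move=> m n mn; rewrite -lee_fin !umE; apply: ge0_le_integral => //.
  - by move=> y _; rewrite lee_fin.
  - by apply/measurable_EFinP; exact: mS.
  - by apply/measurable_EFinP; exact: mS.
  - by move=> y _; rewrite lee_fin fmS.
have umU x : (um m x)%:E @[m --> \oo] --> U x.
  have -> : (fun m => (um m x)%:E) = (fun m => \int[mu]_y (fm m (mehler_pt t x y))%:E)%E.
    by apply/funext => m; exact: umE.
  rewrite /U.
  have -> : (fun y => `|f (mehler_pt t x y)|%:E) = (fun y => limn (fun m => (fm m (mehler_pt t x y))%:E)).
    apply/funext => y; apply/esym/cvg_lim => //; apply: cvg_near_cst.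
    near=> m; congr EFin; apply/min_idPl; near: m; exact: nbhs_infty_ger.
  apply: cvg_monotone_convergence => //.
  - by move=> m; apply/measurable_EFinP; exact: mS.
  - by move=> m y _; rewrite lee_fin.
  - by move=> y _ m n mn; rewrite lee_fin fmS.
have U0 x : (0 <= U x)%E by exact: integral_ge0.
have umq x : ((um m x) `^ q)%:E @[m --> \oo] --> (U x `^ q)%E.
  have umUle m : ((um m x)%:E <= U x)%E.
    apply: cvge_ge (umU x); exists m => // n /= mn; rewrite lee_fin; exact: umS.
  move: (umU x) (U0 x) umUle; case: (U x) => [r||//] h r0 ule.
    rewrite poweR_EFin; apply: cvg_EFin; first exact: nearW.
    apply: cvg_powR_below => //.
      by move=> m; rewrite um0/= -lee_fin.
    by move/fine_cvg : h.
  rewrite poweRyr ?gt_eqF//; apply/cvgeyPge => A.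
  (* Above 1, a power with exponent [q > 1] is at least its base, hence the maximum with 1. *)
  move/cvgeyPge : h => /(_ (Num.max A 1)); apply: filterS => m.
  rewrite !lee_fin ge_max => /andP[h1 h2]; apply: (le_trans h1).
  by rewrite le1r_powR// ltW.
set N := 'N[mu]_(p%:E)[EFin \o f]%E.
have NE : (N `^ p = \int[mu]_x (`|f x| `^ p)%:E)%E.
  by rewrite /N poweR_Lnorm ?gt_eqF//; apply: eq_integral => x _; rewrite /= poweR_EFin.
have N0 : (0 <= N)%E by exact: Lnorm_ge0.
have mpow (g : Rn R d -> R) (r : R) : measurable_fun setT g ->
    measurable_fun setT (fun x => (g x `^ r)%:E).
  by move=> mg; apply/measurable_EFinP; exact: (measurableT_comp (measurable_powR _) mg).
have mainm m : (\int[mu]_x (um m x `^ q)%:E <= N `^ q)%E.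
  apply: le_trans (@bounded_hypercontractive p q t m%:R (fm m) p1 t0 erefl (mfm m) (fmb m)) _.
  rewrite -poweR_EFin (@EFin_Rintegral R _ _ mu _ (m%:R `^ p)); last 2 first.
  - by apply/measurable_EFinP; exact: mpow.
  - move=> x; rewrite powR_ge0/= ge0_ler_powR ?nnegrE ?(ltW p0)//.
    by have /andP[] := fmb m x.
  have -> : (N `^ q = (N `^ p) `^ (q / p))%E.
    by rewrite -poweRrM mulrCA mulfV ?mulr1// gt_eqF.
  rewrite NE; apply: gt0_ler_poweR.
  - by rewrite divr_ge0// ltW.
  - by rewrite in_itv/= leey andbT; apply: integral_ge0 => x _; rewrite lee_fin powR_ge0.
  - by rewrite in_itv/= leey andbT; apply: integral_ge0 => x _; rewrite lee_fin powR_ge0.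
  apply: ge0_le_integral; first exact: measurableT.
  - by move=> x _; rewrite lee_fin powR_ge0.
  - exact: mpow.
  - by apply: mpow; exact: measurableT_comp.
  - by move=> x _; rewrite lee_fin ge0_ler_powR ?nnegrE ?(ltW p0).
have mU : measurable_fun setT U.
  apply: (@measurable_fun_fubini_tonelli_F _ _ _ _ _ mu (fun z => `|f (mehler_pt t z.1 z.2)|%:E)) => //.
  apply/measurable_EFinP; apply: measurableT_comp => //.
  exact: (measurableT_comp mf (@measurable_mehler_pt R d t)).
have mainU : (\int[mu]_x (U x `^ q) <= N `^ q)%E.
  have cU : (\int[mu]_x (um m x `^ q)%:E)%E @[m --> \oo] --> (\int[mu]_x (U x `^ q))%E.
    have -> : (fun x => (U x `^ q)%E) = (fun x => limn (fun m => (um m x `^ q)%:E)).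
      by apply/funext => x; apply/esym/cvg_lim => //; exact: umq.
    apply: cvg_monotone_convergence => //.
    - by move=> m; exact: mpow.
    - by move=> m x _; rewrite lee_fin powR_ge0.
    - by move=> x _ m n mn; rewrite lee_fin ge0_ler_powR ?nnegrE ?(ltW q0)//; exact: umS.
  by apply: cvge_le cU; exact: nearW.
have mOU := measurable_OU t f mf.
have mainOU : (\int[mu]_x (`|OU t f x| `^ q) <= N `^ q)%E.
  apply: le_trans mainU; apply: ge0_le_integral; first exact: measurableT.
  - by move=> x _; exact: poweR_ge0.
  - by apply: (measurableT_comp (measurable_poweR _)); exact: measurableT_comp.
  - exact: (measurableT_comp (measurable_poweR _)).
  move=> x _; apply: gt0_ler_poweR; first exact: ltW.
  - by rewrite in_itv/= abse_ge0 leey.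
  - by rewrite in_itv/= U0 leey.
  - exact: le_abse_OU.
rewrite -(poweR_Lnorm _ _ (lt0r_neq0 q0)) in mainOU.
have := gt0_ler_poweR (ltW (_ : 0 < q^-1)) _ _ mainOU.
rewrite invr_gt0 => /(_ q0); rewrite -!poweRrM mulfV ?gt_eqF//.
rewrite !poweRe1 ?Lnorm_ge0//; apply.
- by rewrite in_itv/= poweR_ge0 leey.
- by rewrite in_itv/= poweR_ge0 leey.
Unshelve. all: by end_near. Qed.

End hypercontractivity.

(** * From hypercontractivity to the exponential form *)

Section jensen.
Context d (T : measurableType d) {R : realType} (P : probability T R).

(* The convention oo - oo = -oo makes this Jensen inequality valid without
   integrability of [h]. *)
Lemma expeR_integral_le (h : T -> R) (p : R) : 0 < p -> measurable_fun setT h ->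
  (expeR (\int[P]_y (h y)%:E) <= (\int[P]_y (expR (h y / p))%:E) `^ p)%E.
Proof.
move=> p0 mh.
have p_neq0 : p != 0 by rewrite gt_eqF.
set J := (\int[P]_y (expR (h y / p))%:E)%E.
have J0 : (0 <= J)%E by apply: integral_ge0 => y _; rewrite lee_fin expR_ge0.
have me : measurable_fun setT (fun y => expR (h y / p)).
  by apply: measurableT_comp => //; exact: measurable_funM.
have [->|Jfin] := eqVneq J +oo%E; first by rewrite poweRyr ?leey.
have Jlt : (J < +oo)%E by rewrite ltey.
have ie : P.-integrable setT (EFin \o (fun y => expR (h y / p))).
  apply/integrableP; split; first exact/measurable_EFinP.
  by under eq_integral do rewrite /= ger0_norm ?expR_ge0//.
case E : (\int[P]_y (h y)%:E)%E => [c||].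
- have ih : P.-integrable setT (EFin \o h).
    apply/integrableP; split; first exact/measurable_EFinP.
    by rewrite (integral_fin_num_abs P measurableT mh) E.
  have Ec : \int[P]_y h y = c by rewrite /Rintegral E.
  have JE : J = (\int[P]_y expR (h y / p))%:E.
    by rewrite /J /Rintegral fineK// ge0_fin_numE.
  rewrite JE poweR_EFin/= lee_fin.
  have -> : expR c = (expR (c / p)) `^ p by rewrite -expRM divfK.
  rewrite ge0_ler_powR ?nnegrE ?expR_ge0 ?(ltW p0)//.
    by apply: Rintegral_ge0 => y _; exact: expR_ge0.
  (* The tangent line of the exponential at [c / p], evaluated at [h / p]: its integral is exactly
     [expR (c / p)]. *)
  have [il el] := @integrable_lin _ _ _ P (expR (c / p) / p) _ _ ih
    (finite_measure_integrable_cst P (expR (c / p) * (1 - c / p)) measurableT).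
  have <- : \int[P]_y (expR (c / p) / p * h y + expR (c / p) * (1 - c / p)) = expR (c / p).
    by rewrite el Ec Rintegral_cst1; ring.
  apply: le_Rintegral => // y _.
  rewrite (_ : _ + _ = expR (c / p) * (1 + (h y / p - c / p))); last by ring.
  rewrite [leRHS](_ : _ = expR (c / p) * expR (h y / p - c / p)); last first.
    by rewrite -expRD addrC subrK.
  by rewrite ler_wpM2l ?expR_ge0// expR_ge1Dx.
(* The value [+oo] cannot occur: [h <= p * expR (h / p)] bounds the positive part by an integrable
   function. *)
- exfalso; have : (\int[P]_y (h y)%:E <= p%:E * J)%E.
    rewrite integralE; apply: (@le_trans _ _ (\int[P]_y (fun y => (h y)%:E)^\+ y)%E).
      by rewrite -[leRHS]sube0; apply: leeB => //; exact: integral_ge0.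
    rewrite /J -ge0_integralZl; last 4 first.
    + exact: measurableT.
    + exact/measurable_EFinP.
    + by move=> y _; rewrite lee_fin expR_ge0.
    + by rewrite lee_fin ltW.
    apply: ge0_le_integral; first exact: measurableT.
    + by move=> y _; exact: funepos_ge0.
    + by apply: measurable_funepos; exact/measurable_EFinP.
    + by apply: emeasurable_funM => //; exact/measurable_EFinP.
    + move=> y _; rewrite !unlock/= -EFinM -EFin_max lee_fin ge_max.
      rewrite mulr_ge0 ?expR_ge0 ?(ltW p0)//= andbT mulrC -ler_pdivrMr//.
      by rewrite (le_trans _ (expR_ge1Dx _))// lerDr.
  by rewrite E -(fineK (_ : J \is a fin_num)) ?ge0_fin_numE// -EFinM leye_eq.
- by rewrite /= poweR_ge0.
Qed.

End jensen.

Lemma le_limn_einf (R : realType) (u v : (\bar R)^nat) :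
  (forall n, u n <= v n)%E -> (limn_einf u <= limn_einf v)%E.
Proof.
move=> uv; rewrite !limn_einf_lim.
apply: lee_lim; [exact: is_cvg_einfs|exact: is_cvg_einfs|apply: nearW => n].
apply: le_ereal_inf_tmp => _ [m /= nm <-]; apply: le_trans (uv m).
by apply: ereal_inf_lbound; exists m.
Qed.

Lemma measurable_expeR (R : realType) : measurable_fun setT (@expeR R).
Proof.
move=> mD; apply: (measurability _ (ErealGenOInfty.measurableE R)) => //.
move=> _ [_ [x ->] <-]; rewrite setTI.
have [x0|x0] := leP 0 x.
  rewrite (_ : _ @^-1` _ = `]lne x%:E, +oo[%classic); first exact: emeasurable_itv.
  apply/funext => w; apply/propext; rewrite /= !in_itv/= !andbT.
  suff -> : (lne x%:E < w)%E = (x%:E < expeR w)%E by [].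
  by rewrite -lte_expeR lneK// in_itv/= lee_fin x0 leey.
rewrite (_ : _ @^-1` _ = setT)//; apply/seteqP; split => // w _ /=.
by rewrite in_itv/= andbT (lt_le_trans _ (expeR_ge0 w))// lte_fin.
Qed.

(** At the infinite values of [w] the powers are constantly [+oo] or 0, because the exponents stay
    positive. *)
Lemma cvg_expeR_poweR (R : realType) (w : \bar R) (s : R^nat) (r : R) :
  0 < r -> (forall n, 0 < s n) -> s n @[n --> \oo] --> r ->
  (expeR w `^ s n)%E @[n --> \oo] --> (expeR w `^ r)%E.
Proof.
move=> r0 s0 sr; case: w => [w||].
- rewrite [expeR _]/=; under eq_fun do rewrite poweR_EFin -expRM.
  rewrite poweR_EFin -expRM; apply: cvg_EFin; first exact: nearW.
  apply: (cvg_comp (fun n => w * s n) (@expR R)); last exact: continuous_expR.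
  exact: cvgMr.
- rewrite [expeR _]/=; under eq_fun do rewrite poweRyr ?gt_eqF//.
  by rewrite poweRyr ?gt_eqF//; exact: cvg_cst.
- rewrite [expeR _]/=; under eq_fun do rewrite poweR0r ?gt_eqF//.
  by rewrite poweR0r ?gt_eqF//; exact: cvg_cst.
Qed.

Lemma cvg_powR_exponent (R : realType) (x : R) (s : R^nat) (r : R) :
  0 <= x -> 0 < r -> (forall n, 0 < s n) -> s n @[n --> \oo] --> r ->
  x `^ s n @[n --> \oo] --> x `^ r.
Proof.
move=> x0 r0 s0 sr; have [->|xn0] := eqVneq x 0.
  under eq_fun do rewrite powR0 ?gt_eqF//.
  by rewrite powR0 ?gt_eqF//; exact: cvg_cst.
rewrite /powR (negbTE xn0).
apply: (cvg_comp (fun n => s n * ln x) (@expR R)); last exact: continuous_expR.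
exact: cvgMl.
Qed.

(** Write [g = exp (f / p)] and let [I] be the integral of [exp f]. The p-th power of the p-norm of
    [g] is [I] for every [p], so the q-th power of that norm is [I^(q/p)] and only the ratio [q / p]
    matters, which tends to [e^(2t)]. *)
Lemma exp_hypercontractivity (R : realType) (d : nat) (f : Rn R d -> R) (t : R) :
  (forall (p : R) (g : Rn R d -> R),
     1 < p -> g \in Lfun (std_gauss R d) p%:E ->
     ('N[std_gauss R d]_((expR (2 * t) * (p - 1) + 1)%:E)[OU t g]
        <= 'N[std_gauss R d]_(p%:E)[EFin \o g])%E) ->
  measurable_fun setT f ->
  expR \o f \in Lfun (std_gauss R d) 1%:E ->
  ('N[std_gauss R d]_((expR (2 * t))%:E)[expeR \o OU t f]
        <= 'N[std_gauss R d]_(1%:E)[EFin \o (expR \o f)])%E.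
Proof.
move=> H mf efL; set mu := std_gauss R d.
pose I := (\int[mu]_x (expR (f x))%:E)%E.
have NI : ('N[mu]_(1%:E)[EFin \o (expR \o f)] = I)%E.
  by rewrite Lnorm1; apply: eq_integral => x _; rewrite /= ger0_norm ?expR_ge0.
have I0 : (0 <= I)%E by apply: integral_ge0 => x _; rewrite lee_fin expR_ge0.
have Ifin : I \is a fin_num.
  rewrite ge0_fin_numE// -NI; move: efL; rewrite inE => /andP[_].
  by rewrite inE.
pose i := fine I; have i0 : 0 <= i by exact: fine_ge0.
have IE : I = i%:E by rewrite fineK.
rewrite NI; set r := expR (2 * t).
have r0 : 0 < r by exact: expR_gt0.
(* All these exponents exceed 1, and the ratio [q n / p n] equals [r + (1 - r) / p n]. *)
pose p (n : nat) : R := n.+2%:R.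
have p1 n : 1 < p n by rewrite ltr1n.
have p0 n : 0 < p n by exact: lt_trans (p1 n).
pose q n := r * (p n - 1) + 1.
pose s n := q n / p n.
have q0 n : 0 < q n by rewrite ltr_wpDl// mulr_ge0 ?(ltW r0)// subr_ge0 ltW.
have s0 n : 0 < s n by rewrite divr_gt0.
have sr : s n @[n --> \oo] --> r.
  have -> : s = (fun n => r + (1 - r) * harmonic n.+1).
    by apply/funext => n; rewrite /s /q /harmonic/= -/(p n); field; rewrite gt_eqF.
  rewrite -[X in _ --> X]addr0 -(mulr0 (1 - r)).
  apply: cvgD; first exact: cvg_cst.
  by apply: cvgMr; move: (@cvg_harmonic R); rewrite -cvg_shiftS.
pose g n x := expR (f x / p n).
have gE n x : g n x `^ p n = expR (f x) by rewrite -expRM divfK ?gt_eqF.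
have mg n : measurable_fun setT (g n).
  by apply: measurableT_comp => //; exact: measurable_funM.
have Ng n : ('N[mu]_((p n)%:E)[EFin \o g n] `^ p n = I)%E.
  rewrite poweR_Lnorm ?gt_eqF//; apply: eq_integral => x _.
  by rewrite /= ger0_norm ?expR_ge0// gE.
have gL n : g n \in Lfun mu (p n)%:E.
  rewrite inE; apply/andP; split; rewrite inE//= /finite_norm.
  apply: (@lty_poweRy _ _ (p n)); first by rewrite gt_eqF.
  by rewrite Ng -ge0_fin_numE.
have mOU := @measurable_OU.
have bound n : (\int[mu]_x (expeR (OU t f x) `^ s n) <= I `^ s n)%E.
  have OUg0 x : (0 <= OU t (g n) x)%E by apply: integral_ge0 => y _; rewrite lee_fin expR_ge0.
  apply: (@le_trans _ _ ('N[mu]_((q n)%:E)[OU t (g n)] `^ q n)%E).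
    rewrite poweR_Lnorm ?gt_eqF//; apply: ge0_le_integral; first exact: measurableT.
    - by move=> x _; exact: poweR_ge0.
    - apply: (measurableT_comp (measurable_poweR _)).
      exact: (measurableT_comp (@measurable_expeR R) (mOU _ _ t f mf)).
    - apply: (measurableT_comp (measurable_poweR _)).
      by apply: measurableT_comp => //; exact: (mOU _ _ t (g n) (mg n)).
    move=> x _; rewrite gee0_abs//.
    have -> : (OU t (g n) x `^ q n = (OU t (g n) x `^ p n) `^ s n)%E.
      by rewrite -poweRrM /s mulrCA mulfV ?mulr1// gt_eqF.
    apply: gt0_ler_poweR; first exact: ltW.
    - by rewrite in_itv/= expeR_ge0 leey.
    - by rewrite in_itv/= poweR_ge0 leey.
    apply: expeR_integral_le => //.
    by apply: (measurableT_comp mf); exact: measurable_mehler_section.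
  rewrite -(Ng n) -poweRrM /s mulrCA mulfV ?mulr1 ?gt_eqF//.
  apply: gt0_ler_poweR; first exact: ltW.
  - by rewrite in_itv/= Lnorm_ge0 leey.
  - by rewrite in_itv/= Lnorm_ge0 leey.
  exact: H (p1 n) (gL n).
have main : (\int[mu]_x (expeR (OU t f x) `^ r) <= I `^ r)%E.
  (* The exponent varies with [n], so the limiting integrand is written as a lower limit for Fatou's
     lemma. *)
  have -> : (fun x => (expeR (OU t f x) `^ r)%E) =
      (fun x => limn_einf (fun n => expeR (OU t f x) `^ s n)%E).
    apply/funext => x.
    by have [-> _] := cvg_limn_einf_sup (cvg_expeR_poweR _ (OU t f x) _ _ r0 s0 sr).
  apply: le_trans (fatou mu measurableT _ _) _.
  - move=> n; apply: (measurableT_comp (measurable_poweR _)).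
    exact: (measurableT_comp (@measurable_expeR R) (mOU _ _ t f mf)).
  - by move=> n x _; exact: poweR_ge0.
  apply: le_trans (le_limn_einf _ _ _ bound) _.
  suff /cvg_limn_einf_sup[-> _] : (I `^ s n)%E @[n --> \oo] --> (I `^ r)%E by [].
  rewrite IE; under eq_fun do rewrite poweR_EFin.
  rewrite poweR_EFin; apply: cvg_EFin; first exact: nearW.
  exact: cvg_powR_exponent.
rewrite unlock.
have -> : (I = (I `^ r) `^ r^-1)%E by rewrite -poweRrM mulfV ?gt_eqF// poweRe1.
apply: gt0_ler_poweR.
- by rewrite invr_ge0 ltW.
- by rewrite in_itv/= leey andbT; apply: integral_ge0 => x _; exact: poweR_ge0.
- by rewrite in_itv/= poweR_ge0 leey.
apply: le_trans main; rewrite le_eqVlt; apply/orP; left; apply/eqP.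
by apply: eq_integral => x _; rewrite /= gee0_abs ?expeR_ge0.
Qed.

Theorem proposition1p1 (R : realType) (d : nat) (hd : (1 <= d)%N) :
  (forall (p : R) (f : Rn R d -> R),
     1 < p -> f \in Lfun (std_gauss R d) p%:E ->
     forall t : R, 0 <= t ->
       ('N[std_gauss R d]_((expR (2 * t) * (p - 1) + 1)%:E)[OU t f]
        <= 'N[std_gauss R d]_(p%:E)[EFin \o f])%E)
  <->
  (forall f : Rn R d -> R,
     f \in Lfun (std_gauss R d) 1%:E ->
     expR \o f \in Lfun (std_gauss R d) 1%:E ->
     forall t : R, 0 <= t ->
       ('N[std_gauss R d]_((expR (2 * t))%:E)[expeR \o OU t f]
        <= 'N[std_gauss R d]_(1%:E)[EFin \o (expR \o f)])%E).
Proof.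
split=> [H f fL efL t t0|_ p f p1 fL t t0]; last exact: hypercontractivity.
apply: exp_hypercontractivity => //.
  by move=> p g p1 gL; exact: H.
by move: fL; rewrite inE => /andP[/[!inE]].
Qed.
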